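(* Let $\nu>-1$ be real. Then for all $x>0$ one has $h(x)<\frac15$, where $h(x)=\dfrac{1}{4\,(I_\nu(x)K_\nu(x))^2}-x^2-\nu^2$; in other words, $$I_\nu(x)K_\nu(x)>\frac{1}{2\sqrt{x^2+\nu^2+\frac15}},\qquad x>0.$$ Moreover, $\frac15$ is the smallest possible constant for which the inequality holds: for every real $c<\frac15$ there exist $\nu>-1$ and $x>0$ with $x^2+\nu^2+c>0$ and $I_\nu(x)K_\nu(x)\le \dfrac{1}{2\sqrt{x^2+\nu^2+c}}$.
   Context: $I_\nu(x)$ and $K_\nu(x)$ denote the modified Bessel functions of the first and second kind, of real order $\nu$ and real argument $x>0$. *)

(* Defs.v *)
From HB Require Import structures.
From mathcomp Require Import all_boot all_order all_algebra.
From mathcomp Require Import all_classical all_reals all_analysis.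

Set Implicit Arguments.
Unset Strict Implicit.
Unset Printing Implicit Defensive.

Import Order.TTheory GRing.Theory Num.Theory.
Import numFieldNormedType.Exports.

Local Open Scope classical_set_scope.
Local Open Scope ring_scope.

(* Euler's integral of the second kind; it is the Gamma function for s > 0
   only (the integral diverges otherwise). *)
Definition Gamma (R : realType) (s : R) : R :=
  \int[lebesgue_measure]_(t in `]0, +oo[) (t `^ (s - 1) * expR (- t)).

Definition cosh (R : realType) (t : R) : R := (expR t + expR (- t)) / 2.

(* Modified Bessel function of the first kind, for nu > -1 and x > 0:
   I_nu(x) = (x/2)^nu * sum_k (x^2/4)^k / (k! Gamma(nu + k + 1)).
   Every argument nu + k + 1 of Gamma is then positive. *)
Definition besselI (R : realType) (nu x : R) : R :=
  (x / 2) `^ nu *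
  limn (series (fun k : nat =>
    (x ^+ 2 / 4) ^+ k / (k`!%:R * Gamma (nu + k%:R + 1)))).

(* Modified Bessel function of the second kind (Macdonald function), for x > 0
   and every real order nu, integers included:
   K_nu(x) = int_0^oo exp(- x cosh t) cosh(nu t) dt. *)
Definition besselK (R : realType) (nu x : R) : R :=
  \int[lebesgue_measure]_(t in `[0, +oo[)
    (expR (- (x * cosh t)) * cosh (nu * t)).

Definition bessel_h (R : realType) (nu x : R) : R :=
  1 / (4 * (besselI nu x * besselK nu x) ^+ 2) - x ^+ 2 - nu ^+ 2.

(* Main.v *)
Require Import Defs.
From mathcomp Require Import all_boot all_order all_algebra.
From mathcomp Require Import all_classical all_reals all_analysis.
From mathcomp Require Import measurable_realfun.
From mathcomp Require Import ring lra.

Import Order.TTheory GRing.Theory Num.Theory.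
Import numFieldNormedType.Exports.

Set Implicit Arguments.
Unset Strict Implicit.
Unset Printing Implicit Defensive.

Local Open Scope classical_set_scope.
Local Open Scope ring_scope.

(* Write theta = x d/dx and q = x^2 + nu^2. Both I_nu and K_nu solve
   theta^2 u = q u, and their Wronskian I theta K - K theta I equals -1, so that
   a = theta I / I and b = - theta K / K satisfy a + b = 1 / (I K) together with
   the Riccati equations theta a + a^2 = q and - theta b + b^2 = q.
   For Q > 0 the WKB functions A = sqrt Q - theta Q / (4 Q) and
   B = sqrt Q + theta Q / (4 Q) satisfy theta A + A^2 = - theta B + B^2 = q + r
   with r = Q - q - theta^2 Q / (4 Q) + 5/16 (theta Q / Q)^2, and A + B = 2 sqrt Q.
   Comparing a with A starting from x = 0 and b with B starting from x = +oo,
   r >= 0 yields 1 / (I K) < 2 sqrt Q, and r <= 0 the reverse inequality.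
   With Q = q + 1/5 and s = x^2 / Q one gets r = 5/4 (s - 2/5)^2 >= 0.
   For the sharpness take Q = q + s - 5/4 s^2 - e with s = x^2 / q: then r <= 0
   for nu large, and Q = q + 1/5 - e at s = 2/5.
   The differential equations come from first-order recurrences between orders
   nu and nu + 1, and the Wronskian is computed in the limit x -> 0. *)

(** The constant comes from solving r = 0 to leading order: as theta q = 2 x^2 and theta^2 q = 4
    x^2, the correction to q is theta^2 q / (4 q) - 5/16 (theta q / q)^2 = s - 5/4 s^2 with s = x^2
    / q, whose maximum is 1/5, reached at s = 2/5. The quotients a and b are never formed. The
    comparison is run on I_nu (a - A) and K_nu (b - B), which satisfy linear first-order equations,
    so that an integrating factor propagates their sign. The two ends need different arguments. Near
    0, a lies between nu and nu + x^2 / (2 (nu + 1)), so a genuine starting point x1 > 0 exists. At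
    infinity there is no starting value: instead, a wrong sign of K_nu (b - B) would persist without
    shrinking, against the exponential decay of K_nu and K_{nu+1}. *)

Section derivation_rules.
Context {R : realType}.
Implicit Types (f g : R -> R) (x df dg : R).

Lemma is_derive_cstf (c x : R) : is_derive x 1 (fun=> c) 0.
Proof. exact: is_derive_cst. Qed.

Lemma is_derive_idf x : is_derive x 1 (fun z : R => z) 1.
Proof. exact: is_derive_id. Qed.

Lemma is_derive_addf f g x df dg : is_derive x 1 f df -> is_derive x 1 g dg ->
  is_derive x 1 (fun z => f z + g z) (df + dg).
Proof. exact: is_deriveD. Qed.

Lemma is_derive_oppf f x df : is_derive x 1 f df ->
  is_derive x 1 (fun z => - f z) (- df).
Proof. exact: is_deriveN. Qed.

Lemma is_derive_mulf f g x df dg : is_derive x 1 f df -> is_derive x 1 g dg ->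
  is_derive x 1 (fun z => f z * g z) (df * g x + f x * dg).
Proof.
move=> dF dG; have := is_deriveM dF dG.
by rewrite /GRing.scale/= [X in is_derive _ _ _ X]addrC [g x * df]mulrC.
Qed.

Lemma is_derive_sqrf f x df : is_derive x 1 f df ->
  is_derive x 1 (fun z => f z ^+ 2) (2 * f x * df).
Proof.
by move=> dF; apply: (is_derive_eq (is_derive_mulf dF dF)); ring.
Qed.

Lemma is_derive_invf f x df : f x != 0 -> is_derive x 1 f df ->
  is_derive x 1 (fun z => (f z)^-1) (- (f x) ^- 2 * df).
Proof. by move=> fx0 dF; exact: (is_deriveV fx0 dF). Qed.

Lemma is_derive_expf f x df : is_derive x 1 f df ->
  is_derive x 1 (fun z => expR (f z)) (expR (f x) * df).
Proof. by move=> dF; exact: (is_derive1_comp (is_derive_expR (f x)) dF). Qed.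

Lemma is_derive_sqrtf f x df : 0 < f x -> is_derive x 1 f df ->
  is_derive x 1 (fun z => Num.sqrt (f z)) ((2 * Num.sqrt (f x))^-1 * df).
Proof. by move=> fx0 dF; exact: (is_derive1_comp (is_derive1_sqrt fx0) dF). Qed.

Lemma is_derive_powf f x df (a : R) : 0 < f x -> is_derive x 1 f df ->
  is_derive x 1 (fun z => f z `^ a) (a * f x `^ (a - 1) * df).
Proof. by move=> fx0 dF; exact: (is_derive1_comp (is_derive1_powR a fx0) dF). Qed.

End derivation_rules.

(** The rules above are stated on [fun z => ...] so that the shape of the body selects them.
    Constants come first, to keep closed subterms whole; the last case takes side conditions and
    derivatives of opaque functions from the context. *)
Ltac derive_step :=
  lazymatch goal with
  | |- is_derive _ _ (fun _ => ?c) _ => eapply is_derive_cstf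
  | |- is_derive _ _ (fun z => @?f z + @?g z) _ => eapply (@is_derive_addf _ f g)
  | |- is_derive _ _ (fun z => - @?f z) _ => eapply (@is_derive_oppf _ f)
  | |- is_derive _ _ (fun z => @?f z * @?g z) _ => eapply (@is_derive_mulf _ f g)
  | |- is_derive _ _ (fun z => @?f z ^+ 2) _ => eapply (@is_derive_sqrf _ f)
  | |- is_derive _ _ (fun z => (@?f z)^-1) _ => eapply (@is_derive_invf _ f)
  | |- is_derive _ _ (fun z => expR (@?f z)) _ => eapply (@is_derive_expf _ f)
  | |- is_derive _ _ (fun z => Num.sqrt (@?f z)) _ =>
      eapply (@is_derive_sqrtf _ f)
  | |- is_derive _ _ (fun z => @?f z `^ _) _ => eapply (@is_derive_powf _ f)
  | |- is_derive _ _ (fun z => z) _ => eapply is_derive_idf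
  | |- _ => eassumption
  end.

Ltac derive_tac := eapply is_derive_eq; [repeat derive_step|].

(** * Calculus on the half-line: sign propagation, exhaustion of integrals, majorants *)

Section calculus.
Context {R : realType}.
Notation mu := (@lebesgue_measure R).
Implicit Types (F f g : R -> R) (a b x : R).

Lemma is_derive_continuous F x df : is_derive x 1 F df -> {for x, continuous F}.
Proof.
by move=> dF; apply: differentiable_continuous; exact/derivable1_diffP.
Qed.

Lemma is_derive_within_continuous F (dF : R -> R) a b :
  (forall x, a <= x <= b -> is_derive x 1 F (dF x)) ->
  {within `[a, b], continuous F}.
Proof.
move=> h; apply: derivable_within_continuous => x.
by rewrite in_itv/= => /h [].
Qed.

Lemma is_derive_le0_le F (dF : R -> R) a b : a <= b ->
  (forall x, a <= x <= b -> is_derive x 1 F (dF x)) ->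
  (forall x, a <= x <= b -> dF x <= 0) -> F b <= F a.
Proof.
move=> ab dFE dF0.
have [|c cab] := @MVT_segment _ F dF _ _ ab _ (is_derive_within_continuous dFE).
  by move=> x; rewrite in_itv/= => /andP[ax xb]; apply: dFE; rewrite !ltW.
move=> h; rewrite -subr_le0 h mulr_le0_ge0 ?subr_ge0//.
by apply: dF0; rewrite in_itv in cab.
Qed.

Lemma is_derive0_eq F a b : a <= b ->
  (forall x, a <= x <= b -> is_derive x 1 F 0) -> F a = F b.
Proof.
move=> ab dFE; apply/eqP; rewrite eq_sym -subr_eq0; apply/eqP.
have [|c _] := @MVT_segment _ F (fun=> 0) _ _ ab _ (is_derive_within_continuous dFE).
  by move=> x; rewrite in_itv/= => /andP[ax xb]; apply: dFE; rewrite !ltW.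
by rewrite mul0r.
Qed.

Lemma primitive_exists f a b : 0 < a ->
  (forall x, 0 < x -> {for x, continuous f}) ->
  exists G, forall x, a <= x <= b -> is_derive x 1 G (f x).
Proof.
(* The lower limit a / 2 and integrability up to b + 1 put [[a, b]] in the interior, so the
   derivative is two-sided at a and b as well. *)
move=> a0 cf; exists (fun x => \int[mu]_(t in `[a / 2, x]) f t) => x /andP[ax xb].
have ifx : mu.-integrable `[a / 2, b + 1] (EFin \o f).
  apply: continuous_compact_integrable; first exact: segment_compact.
  apply: continuous_in_subspaceT => z /set_mem/=; rewrite in_itv/= => /andP[az _].
  by apply: cf; rewrite (lt_le_trans _ az)// divr_gt0.
have xb1 : x < b + 1 by lra.
have a2x : a / 2 < x by lra.
have x0 : 0 < x by lra.
have [dG GE] := continuous_FTC1_closed xb1 ifx a2x (cf _ x0).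
by apply: DeriveDef; [exact: dG|rewrite -derive1E; exact: GE].
Qed.

(** With G a primitive of [f], D exp G is nonincreasing, and the factor exp G does not affect the
    sign. *)
Lemma gronwall_lt0 D (dD : R -> R) f a b : 0 < a -> a <= b ->
  (forall x, 0 < x -> {for x, continuous f}) ->
  (forall x, 0 < x -> is_derive x 1 D (dD x)) ->
  (forall x, 0 < x -> dD x + f x * D x <= 0) ->
  D a < 0 -> D b < 0.
Proof.
move=> a0 ab cf dDE dD0 Da; have [G dG] := @primitive_exists f a b a0 cf.
have h : D b * expR (G b) <= D a * expR (G a).
  apply: (@is_derive_le0_le (fun x => D x * expR (G x))
    (fun x => (dD x + f x * D x) * expR (G x))) => // x /[dup] xab /andP[ax _].
    have ? := dG _ xab; have ? := dDE _ (lt_le_trans a0 ax).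
    derive_tac; ring.
  by rewrite mulr_le0_ge0 ?expR_ge0// dD0// (lt_le_trans a0).
rewrite -(pmulr_llt0 _ (expR_gt0 (G b))); apply: le_lt_trans h _.
by rewrite pmulr_llt0// expR_gt0.
Qed.

Lemma integrable_scalef (D : set (measurableTypeR R)) f (c : R) :
  measurable D -> mu.-integrable D (EFin \o f) ->
  mu.-integrable D (EFin \o (fun x => c * f x)).
Proof. by move=> mD fi; exact: (integrableZl mD c fi). Qed.

Lemma integrable_addf (D : set (measurableTypeR R)) f g : measurable D ->
  mu.-integrable D (EFin \o f) -> mu.-integrable D (EFin \o g) ->
  mu.-integrable D (EFin \o (fun x => f x + g x)).
Proof. by move=> mD fi gi; exact: (integrableD mD fi gi). Qed.

Lemma integrable_subf (D : set (measurableTypeR R)) f g : measurable D ->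
  mu.-integrable D (EFin \o f) -> mu.-integrable D (EFin \o g) ->
  mu.-integrable D (EFin \o (fun x => f x - g x)).
Proof. by move=> mD fi gi; exact: (integrableB mD fi gi). Qed.

Lemma integrable_sub (D E : set (measurableTypeR R)) f :
  measurable D -> measurable E -> E `<=` D ->
  mu.-integrable D (EFin \o f) -> mu.-integrable E (EFin \o f).
Proof. by move=> mD mE ED; exact: integrableS. Qed.

(** Dominated convergence for [f] cut off outside [A n], with |f| as majorant; the sets only have to
    contain each point eventually, not to be nested. *)
Lemma cvg_Rintegral_exhaust (D : set (measurableTypeR R))
    (A : nat -> set (measurableTypeR R)) f :
  measurable D -> (forall n, measurable (A n)) -> (forall n, A n `<=` D) ->
  (forall x, D x -> \forall n \near \oo, A n x) ->
  mu.-integrable D (EFin \o f) ->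
  \int[mu]_(x in A n) f x @[n --> \oo] --> \int[mu]_(x in D) f x.
Proof.
move=> mD mA AD nA intf.
have iA n : mu.-integrable D (EFin \o (f \_ (A n))).
  rewrite -restrict_EFin.
  apply/(integrable_restrict mu (mA n) mD (EFin \o f)).
  rewrite setIidr; last exact: AD.
  exact: (integrableS mD (mA n) (AD n) intf).
have [] := @dominated_convergence _ _ _ mu D mD (fun n => EFin \o (f \_ (A n)))
  (EFin \o f) (fun x => `|(f x)%:E|)%E.
- by move=> n; exact: measurable_int (iA n).
- exact: measurable_int intf.
- apply: aeW => x Dx; apply: cvg_near_cst; near=> n.
  by rewrite /= patchE mem_set//; near: n; exact: nA.
- exact: integrable_abse intf.
- apply: aeW => x n Dx /=; rewrite patchE; case: ifP => _ //.
  by rewrite normr0 lee_fin.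
move=> _ _ h.
have fE : (\int[mu]_(x in D) (EFin \o f) x)%E = (\int[mu]_(x in D) f x)%:E.
  by rewrite /Rintegral fineK//; exact: integrable_fin_num.
rewrite fE in h.
apply: cvg_trans (fine_cvg h); apply: near_eq_cvg; apply: nearW => n /=.
rewrite /Rintegral; congr fine.
transitivity (\int[mu]_(x in D `&` A n) (f x)%:E)%E; last first.
  by rewrite (setIidr (@AD n)).
by rewrite integral_mkcondr; apply: eq_integral => x _; rewrite restrict_EFin.
Unshelve. all: by end_near. Qed.

(** A zero integral would make [f] vanish almost everywhere on D; the segment [[a, b]] certifies
    that D is not null. *)
Lemma Rintegral_gt0 (D : set (measurableTypeR R)) f a b : measurable D -> a < b ->
  `[a, b] `<=` D -> mu.-integrable D (EFin \o f) ->
  (forall x, D x -> 0 < f x) -> 0 < \int[mu]_(x in D) f x.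
Proof.
move=> mD ab abD intf f0.
rewrite lt_neqAle Rintegral_ge0 ?andbT; last by move=> x /f0/ltW.
apply/eqP => /esym int0.
have h : (\int[mu]_(x in D) `|(EFin \o f) x| = 0)%E.
  transitivity (\int[mu]_(x in D) (f x)%:E)%E.
    by apply: eq_integral => x /set_mem/f0 fx; rewrite /= gtr0_norm.
  by rewrite -[LHS]fineK ?(integrable_fin_num mD)//; congr EFin.
have /(ae_eq_integral_abs mu mD (measurable_int mu intf)) [N [mN N0 subN]] := h.
have : (mu `[a, b] <= mu N)%E.
  apply: le_measure; rewrite ?inE// => x /abD Dx; apply: subN => /= /(_ Dx) [].
  by move=> fx; have := f0 _ Dx; rewrite fx ltxx.
by rewrite N0 lebesgue_measure_itv/= lte_fin ab -EFinD lee_fin leNgt subr_gt0 ab.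
Qed.

Lemma continuous_pos_measurable f : (forall x, 0 < x -> {for x, continuous f}) ->
  measurable_fun `](0 : R), +oo[ (EFin \o f).
Proof.
move=> cf; apply/measurable_EFinP; apply: open_continuous_measurable_fun => //.
by move=> x /set_mem/=; rewrite in_itv/= andbT => /cf.
Qed.

Let exhaust (n : nat) : set R := `[n.+1%:R^-1, n.+1%:R]%classic.

Lemma exhaust_sub n : exhaust n `<=` `]0, +oo[.
Proof.
move=> x; rewrite /exhaust/= !in_itv/= andbT => /andP[+ _].
by apply: lt_le_trans; rewrite invr_gt0 ltr0n.
Qed.

Lemma exhaust_near x : `]0, +oo[%classic x -> \forall n \near \oo, exhaust n x.
Proof.
rewrite /= in_itv/= andbT => x0; near=> n.
rewrite /exhaust/= in_itv/=; apply/andP; split.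
  by apply: ltW; near: n; exact: (near_infty_natSinv_lt (PosNum x0)).
rewrite (@le_trans _ _ n%:R)// ?ler_nat//; near: n; exact: nbhs_infty_ger.
Unshelve. all: by end_near. Qed.

Lemma exhaust_lt n : (0 < n)%N -> n.+1%:R^-1 < n.+1%:R :> R.
Proof.
by move=> n0; rewrite (@lt_trans _ _ 1) ?invf_lt1 ?ltr0n ?ltr1n// ltnS.
Qed.

Lemma exhaust_integral F f n :
  (forall x, 0 < x -> is_derive x 1 F (f x)) ->
  (forall x, 0 < x -> {for x, continuous f}) ->
  n.+1%:R^-1 < n.+1%:R :> R ->
  (\int[mu]_(x in exhaust n) (f x)%:E = (F n.+1%:R)%:E - (F n.+1%:R^-1)%:E)%E.
Proof.
move=> dF cf n1.
have n0 : 0 < n.+1%:R^-1 :> R by rewrite invr_gt0.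
apply: (@continuous_FTC2 _ f F _ _ n1).
- apply: continuous_in_subspaceT => x /set_mem/=; rewrite in_itv/= => /andP[nx _].
  by apply: cf; exact: lt_le_trans nx.
- split.
  + move=> x; rewrite in_itv/= => /andP[nx _].
    by have [] := dF _ (lt_trans n0 nx).
  + by apply: cvg_at_right_filter; exact: is_derive_continuous (dF _ n0).
  + apply: cvg_at_left_filter.
    exact: is_derive_continuous (dF _ (lt_trans n0 n1)).
- move=> x; rewrite in_itv/= => /andP[nx _].
  by rewrite derive1E; have [] := dF _ (lt_trans n0 nx).
Qed.

(** The form in which integration by parts is used: the combination of integrals to be shown zero is
    merged into one integrand whose primitive vanishes at both ends. *)
Lemma Rintegral_derive0 F f :
  (forall x, 0 < x -> is_derive x 1 F (f x)) ->
  (forall x, 0 < x -> {for x, continuous f}) ->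
  mu.-integrable `]0, +oo[ (EFin \o f) ->
  F (n.+1%:R^-1) @[n --> \oo] --> 0 -> F n.+1%:R @[n --> \oo] --> 0 ->
  \int[mu]_(x in `]0, +oo[) f x = 0.
Proof.
move=> dF cf intf F0 Foo.
have h := @cvg_Rintegral_exhaust `]0, +oo[ exhaust f.
have {}h := h (measurable_itv _) (fun n => measurable_itv _) exhaust_sub
  exhaust_near intf.
apply: (cvg_unique _ h) => //.
rewrite /= -[X in _ --> X](subr0 0).
apply: cvg_trans (cvgB Foo F0); apply: near_eq_cvg; near=> n.
have n1 : n.+1%:R^-1 < n.+1%:R :> R.
  by apply: exhaust_lt; near: n; exists 1%N.
by rewrite /Rintegral (exhaust_integral dF cf n1).
Unshelve. all: by end_near. Qed.

(** Monotone convergence along the exhausting segments, where each integral is a difference of two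
    values of [F], hence at most 2 C. This is the source of the integrable majorants below. *)
Lemma integrable_derive_bounded F f (C : R) :
  (forall x, 0 < x -> is_derive x 1 F (f x)) ->
  (forall x, 0 < x -> {for x, continuous f}) ->
  (forall x, 0 < x -> 0 <= f x) ->
  (forall x, 0 < x -> `|F x| <= C) ->
  mu.-integrable `]0, +oo[ (EFin \o f).
Proof.
move=> dF cf f0 FC.
have mf := continuous_pos_measurable cf.
apply/integrableP; split=> //.
have -> : (\int[mu]_(x in `]0%R, +oo[) `|(EFin \o f) x| =
    \int[mu]_(x in `]0%R, +oo[) (f x)%:E)%E.
  apply: eq_integral => x /set_mem/=; rewrite in_itv/= andbT => /f0 fx.
  by rewrite ger0_norm.
have UE : `]0, +oo[%classic = \bigcup_n exhaust n.
  apply/seteqP; split=> [x /exhaust_near [n _ /(_ n (leqnn n)) h]|x [n _]].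
    by exists n.
  exact: exhaust_sub.
have ndE : nondecreasing_seq exhaust.
  apply/nondecreasing_seqP => n; rewrite subsetEset /exhaust => x /=.
  rewrite !in_itv/= => /andP[h1 h2]; apply/andP; split.
    by apply: le_trans h1; rewrite lef_pV2 ?posrE ?ltr0n// ler_nat.
  by apply: le_trans h2 _; rewrite ler_nat.
have h : (\int[mu]_(x in exhaust n) (f x)%:E @[n --> \oo] -->
    \int[mu]_(x in \bigcup_n exhaust n) (f x)%:E)%E.
  apply: ge0_nondecreasing_set_cvg_integral => //.
  - by move=> n; exact: measurable_itv.
  - move=> n; apply: measurable_funS mf; first exact: measurable_itv.
    exact: exhaust_sub.
  - move=> n x /exhaust_sub; rewrite /= in_itv/= andbT => /f0.
    by rewrite lee_fin.
rewrite UE; apply: (@le_lt_trans _ _ (C + C)%:E); last exact: ltry.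
rewrite -(cvg_lim _ h)//; apply: lime_le; first by apply/cvg_ex; eexists; exact: h.
near=> n.
have n1 : n.+1%:R^-1 < n.+1%:R :> R.
  by apply: exhaust_lt; near: n; exists 1%N.
rewrite exhaust_integral//.
have n0 : 0 < n.+1%:R :> R by rewrite ltr0n.
have n0' : 0 < n.+1%:R^-1 :> R by rewrite invr_gt0.
rewrite -EFinB lee_fin; apply: le_trans (ler_norm _) _.
by apply: le_trans (ler_normB _ _) _; rewrite lerD// FC.
Unshelve. all: by end_near. Qed.

End calculus.

(** * The Gamma integral: convergence, positivity, functional equation *)

Section gamma.
Context {R : realType}.
Notation mu := (@lebesgue_measure R).
Implicit Types (s t a c x : R).

Lemma ln_le_subr1 x : 0 < x -> ln x <= x - 1.
Proof.
move=> x0; have := @le_ln1Dx R (x - 1).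
by rewrite [1 + _]addrC subrK; apply; rewrite ltrBrDl subrr.
Qed.

Lemma powR_expRN_bounded a : 0 < a ->
  exists2 C : R, 0 <= C & forall t, 0 < t -> t `^ a * expR (- t) <= C.
Proof.
(* The bound is the value at the maximum t = a; it follows from ln (t / a) <= t / a - 1. *)
move=> a0; exists (expR (a * ln a - a)); first exact: expR_ge0.
move=> t t0; rewrite /powR gt_eqF// -expRD ler_expR lerBlDr.
have := ler_wpM2l (ltW a0) (ln_le_subr1 (divr_gt0 t0 a0)).
rewrite ln_div// !mulrBr mulr1 mulrCA divff ?gt_eqF// mulr1; lra.
Qed.

Lemma cvg_powR_natSinv a : 0 < a -> (n.+1%:R^-1 : R) `^ a @[n --> \oo] --> 0.
Proof.
move=> a0; apply/cvgrPdist_lt => e e0.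
have ea0 : 0 < e `^ a^-1 by exact: powR_gt0.
near=> n; rewrite sub0r normrN ger0_norm ?powR_ge0//.
have -> : e = (e `^ a^-1) `^ a by rewrite -powRrM mulVf ?gt_eqF// powRr1// ltW.
apply: gt0_ltr_powR => //; rewrite ?nnegrE ?invr_ge0 ?ler0n ?powR_ge0//.
by near: n; exact: (near_infty_natSinv_lt (PosNum ea0)).
Unshelve. all: by end_near. Qed.

Lemma is_derive_powR_expRN a t : 0 < t ->
  is_derive t 1 (fun t => t `^ a * expR (- t))
    (a * (t `^ (a - 1) * expR (- t)) - t `^ a * expR (- t)).
Proof.
by move=> t0; derive_tac; ring.
Qed.

Lemma Gamma_continuous s t : 0 < t ->
  {for t, continuous (fun t => t `^ (s - 1) * expR (- t))}.
Proof. by move=> t0; exact: is_derive_continuous (is_derive_powR_expRN _ t0). Qed.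

Lemma Gamma_integrable s : 0 < s ->
  mu.-integrable `]0, +oo[ (EFin \o (fun t => t `^ (s - 1) * expR (- t))).
Proof.
move=> s0.
have [C C0 hC] := powR_expRN_bounded (mulr_gt0 (ltr0Sn R 1) s0).
(* The majorant [h] is the derivative of - D / (1 + t^s), so one function serves both ends. With
   this D it equals t^(s-1) (2 + 2 C) / (1 + t^s)^2, and exp(-t) (1 + t^s)^2 <= 2 + 2 C because (1 +
   v)^2 <= 2 + 2 v^2 and t^(2 s) exp(-t) <= C. *)
pose D := (2 + 2 * C) / s.
have D0 : 0 <= D by apply: divr_ge0; [lra|exact: ltW].
pose H t := - D * (1 + t `^ s)^-1.
pose h t := D * (s * t `^ (s - 1)) / (1 + t `^ s) ^+ 2.
have p1 t : 0 < 1 + t `^ s by rewrite ltr_wpDr// powR_ge0.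
have dH t : 0 < t -> is_derive t 1 H (h t).
  move=> t0; have p1n : 1 + t `^ s != 0 by rewrite gt_eqF.
  by rewrite /H; derive_tac; rewrite /h; field.
have ch t : 0 < t -> {for t, continuous h}.
  move=> t0; have p1n : (1 + t `^ s) ^+ 2 != 0 by rewrite expf_neq0// gt_eqF.
  by rewrite /h; eapply is_derive_continuous; repeat derive_step.
have h0 t : 0 <= h t.
  apply: divr_ge0; last by rewrite exprn_ge0// ltW.
  by apply: mulr_ge0 => //; apply: mulr_ge0; [exact: ltW|exact: powR_ge0].
have ih : mu.-integrable `]0, +oo[ (EFin \o h).
  apply: (integrable_derive_bounded (C := D) dH ch).
  - by move=> t _; exact: h0.
  - move=> t t0; rewrite /H normrM normrN (ger0_norm D0) ler_piMr//.
    by rewrite ger0_norm ?invf_le1// ?lerDl ?powR_ge0// invr_ge0 ltW.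
apply: le_integrable ih => //.
  exact: continuous_pos_measurable (@Gamma_continuous s).
move=> t /=; rewrite in_itv/= andbT => t0.
rewrite lee_fin !ger0_norm//; last first.
  by rewrite mulr_ge0 ?powR_ge0 ?expR_ge0.
have -> : h t = t `^ (s - 1) * ((2 + 2 * C) / (1 + t `^ s) ^+ 2).
  by rewrite /h /D; field; rewrite !gt_eqF.
apply: ler_wpM2l; first exact: powR_ge0.
rewrite ler_pdivlMr ?exprn_gt0//.
have e1 : expR (- t) <= 1 by rewrite -expR0 ler_expR oppr_le0 ltW.
have := hC _ t0; rewrite [2 * s]mulrC powRrM powR_mulrn ?powR_ge0//.
have := expR_ge0 (- t); move: (expR (- t)) e1 (t `^ s) => u u1 v u0 huv.
have : 0 <= u * (1 - v) ^+ 2 by rewrite mulr_ge0// sqr_ge0.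
rewrite !expr2 in huv *; lra.
Qed.

Lemma Gamma_gt0 s : 0 < s -> 0 < Gamma s.
Proof.
move=> s0; apply: (@Rintegral_gt0 _ _ _ 1 2) => //.
- by rewrite ltr1n.
- move=> x /=; rewrite !in_itv/= andbT => /andP[+ _]; exact: lt_le_trans.
- exact: Gamma_integrable.
- move=> x /=; rewrite in_itv/= andbT => x0.
  by rewrite mulr_gt0 ?powR_gt0 ?expR_gt0.
Qed.

Lemma GammaS s : 0 < s -> Gamma (s + 1) = s * Gamma s.
Proof.
move=> s0; apply/eqP; rewrite eq_sym -subr_eq0; apply/eqP.
have i0 := Gamma_integrable s0.
have i1 := Gamma_integrable (addr_gt0 s0 ltr01).
rewrite /Gamma -RintegralZl// -RintegralB//; last first.
  exact: integrable_scalef.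
(* The boundary term t^s exp(-t) is at most t^s near 0, and at most C / t at infinity by the bound
   for the exponent s + 1. *)
have [C C0 hC] := powR_expRN_bounded (addr_gt0 s0 ltr01).
apply: (@Rintegral_derive0 _ (fun t => t `^ s * expR (- t))).
- by move=> t t0; have := is_derive_powR_expRN s t0; rewrite addrK.
- move=> t t0; apply: continuousB; last exact: Gamma_continuous.
  by apply: continuousM; [exact: cst_continuous|exact: Gamma_continuous].
- by apply: integrable_subf => //; exact: integrable_scalef.
- apply: (squeeze_cvgr _ (cvg_cst 0) (cvg_powR_natSinv s0)); apply: nearW => n.
  rewrite mulr_ge0 ?powR_ge0 ?expR_ge0//= ler_piMr ?powR_ge0//.
- have hC0 : C * n.+1%:R^-1 @[n --> \oo] --> 0.
    rewrite -[X in _ --> X](mulr0 C).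
    by apply: cvgM; [exact: cvg_cst|exact: cvg_harmonic].
  apply: (squeeze_cvgr _ (cvg_cst 0) hC0); apply: nearW => n.
  rewrite mulr_ge0 ?powR_ge0 ?expR_ge0//= ler_pdivlMr ?ltr0n//.
  apply: le_trans (hC n.+1%:R (ltr0Sn _ _)).
  rewrite powRD ?powRr1 ?ler0n//; last by rewrite pnatr_eq0 implybT.
  by rewrite mulrAC.
Qed.

End gamma.

(** * Macdonald's function: integrands, recurrences, decay *)

Section macdonald.
Context {R : realType}.
Notation mu := (@lebesgue_measure R).
Implicit Types (m x t : R).

(** Exponential half of the integrand of K_m: for t >= 0 it is monotone in m over all real orders,
    and exp (m t) becomes a single power under t = ln (u / d). *)
Definition expK m x t : R := expR (- (x * cosh t)) * expR (m * t).

Definition coshK m x t : R := expR (- (x * cosh t)) * cosh (m * t).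

Lemma cosh_ge1 t : 1 <= cosh t.
Proof.
rewrite /cosh expRN ler_pdivlMr// mul1r.
have u0 := expR_gt0 t; rewrite -subr_ge0.
have -> : expR t + (expR t)^-1 - 2 = (expR t - 1) ^+ 2 / expR t.
  by field; rewrite gt_eqF.
by rewrite divr_ge0 ?sqr_ge0 ?ltW.
Qed.

Lemma cosh_gt0 t : 0 < cosh t.
Proof. exact: lt_le_trans (cosh_ge1 t). Qed.

Lemma cosh_ge_sqr t : 0 <= t -> t ^+ 2 / 8 <= cosh t.
Proof.
move=> t0; have e0 := expR_gt0 (- t).
have h : (1 + t / 2) ^+ 2 <= expR t.
  have -> : expR t = expR (t / 2) ^+ 2 by rewrite -expRM_natl; congr expR; field.
  by rewrite lerXn2r ?nnegrE ?expR_ge0 ?expR_ge1Dx//; lra.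
rewrite /cosh; move: h; rewrite !expr2; lra.
Qed.

Lemma is_derive_cosh (f : R -> R) x df : is_derive x 1 f df ->
  is_derive x 1 (fun z : R => cosh (f z)) (((expR (f x) - expR (- f x)) / 2) * df).
Proof. by move=> dF; rewrite /cosh; derive_tac; ring. Qed.

Lemma is_derive_expK m x t : is_derive t 1 (expK m x)
  ((m - x * ((expR t - expR (- t)) / 2)) * expK m x t).
Proof.
have dc := is_derive_cosh (is_derive_idf t).
rewrite /expK; eapply is_derive_eq.
  eapply (@is_derive_mulf _ (fun t => expR (- (x * cosh t)))
    (fun t => expR (m * t))).
    eapply is_derive_expf, is_derive_oppf.
    by eapply (@is_derive_mulf _ (fun=> x)); [exact: is_derive_cstf|exact: dc].
  by repeat derive_step.
by ring.
Qed.

Lemma expK_continuous m x : continuous (expK m x).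
Proof. by move=> t; exact: is_derive_continuous (is_derive_expK m x t). Qed.

Lemma expK_gt0 m x t : 0 < expK m x t.
Proof. by rewrite mulr_gt0 ?expR_gt0. Qed.

(** As cosh t >= t^2 / 8, completing the square in - x t^2 / 8 + (|m| + 1) t gives the maximum 2
    (|m| + 1)^2 / x; the extra 1 pays for the factor exp(-t). *)
Lemma expK_bound m x : 0 < x -> exists2 C : R, 0 <= C &
  forall t, 0 <= t -> expK m x t <= C * expR (- t).
Proof.
move=> x0; exists (expR (2 * (`|m| + 1) ^+ 2 / x)); first exact: expR_ge0.
move=> t t0; rewrite /expK -!expRD ler_expR.
have h1 := ler_wpM2l (ltW x0) (cosh_ge_sqr t0).
have h2 := ler_wpM2r t0 (ler_norm m).
have : 0 <= x / 8 * (t - 4 * (`|m| + 1) / x) ^+ 2.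
  by rewrite mulr_ge0 ?sqr_ge0// divr_ge0// ltW.
have -> : x / 8 * (t - 4 * (`|m| + 1) / x) ^+ 2 =
  x * (t ^+ 2 / 8) - (`|m| + 1) * t + 2 * (`|m| + 1) ^+ 2 / x.
  by field; rewrite gt_eqF.
lra.
Qed.

Lemma integrable_halfline (f : R -> R) : continuous f ->
  mu.-integrable `]0, +oo[ (EFin \o f) -> mu.-integrable `[0, +oo[ (EFin \o f).
Proof.
move=> cf /integrableP[mf intf].
have mfT : measurable_fun setT f by exact: continuous_measurable_fun.
apply/integrableP; split.
  by apply/measurable_EFinP; apply: measurable_funS mfT.
rewrite -integral_itv_obnd_cbnd//.
by apply: measurableT_comp => //.
Qed.

Lemma expK_integrable m x : 0 < x -> mu.-integrable `[0, +oo[ (EFin \o expK m x).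
Proof.
move=> x0; apply: integrable_halfline; first exact: expK_continuous.
have [C C0 hC] := expK_bound m x0.
have ih : mu.-integrable `]0, +oo[ (EFin \o (fun t => C * expR (- t))).
  apply: (integrable_derive_bounded (F := fun t => - C * expR (- t)) (C := C)).
  - by move=> t _; derive_tac; ring.
  - by move=> t _; eapply is_derive_continuous; repeat derive_step.
  - by move=> t _; rewrite mulr_ge0// expR_ge0.
  - move=> t t0; rewrite normrM normrN (ger0_norm C0) ler_piMr//.
    rewrite ger0_norm ?expR_ge0//.
    by rewrite expR_le1 oppr_le0 ltW.
apply: le_integrable ih => //.
  by apply: continuous_pos_measurable => t _; exact: expK_continuous.
move=> t /=; rewrite in_itv/= andbT => t0.
rewrite lee_fin !ger0_norm ?mulr_ge0 ?expR_ge0//.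
exact: hC (ltW t0).
Qed.

Lemma coshKE m x : coshK m x = fun t => 2^-1 * (expK m x t + expK (- m) x t).
Proof. by apply/funext => t; rewrite /coshK /expK /cosh mulNr; field. Qed.

Lemma coshK_integrable m x : 0 < x ->
  mu.-integrable `[0, +oo[ (EFin \o coshK m x).
Proof.
move=> x0; rewrite coshKE; apply: integrable_scalef => //.
by apply: integrable_addf => //; exact: expK_integrable.
Qed.

Lemma coshK_continuous m x : continuous (coshK m x).
Proof.
move=> t; rewrite coshKE.
have ? := is_derive_expK m x t; have ? := is_derive_expK (- m) x t.
by eapply is_derive_continuous; repeat derive_step.
Qed.

Lemma coshK_gt0 m x t : 0 < coshK m x t.
Proof. by rewrite mulr_gt0 ?expR_gt0 ?cosh_gt0. Qed.

Lemma besselK_gt0 m x : 0 < x -> 0 < besselK m x.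
Proof.
move=> x0; apply: (@Rintegral_gt0 _ _ _ 1 2) => //.
- by rewrite ltr1n.
- by move=> t /=; rewrite !in_itv/= andbT => /andP[+ _]; exact: le_trans.
- exact: coshK_integrable.
- by move=> t _; exact: coshK_gt0.
Qed.

Lemma besselK_expK m x : 0 < x -> besselK m x =
  2^-1 * (\int[mu]_(t in `[0, +oo[) expK m x t +
          \int[mu]_(t in `[0, +oo[) expK (- m) x t).
Proof.
move=> x0; have im := expK_integrable m x0; have iN := expK_integrable (- m) x0.
rewrite -RintegralD// -RintegralZl//; last exact: integrable_addf.
by rewrite -coshKE.
Qed.

(** Differentiation in x brings down - cosh t; this identity turns the result into - (K_{m+1} +
    K_{m-1}) / 2. *)
Lemma coshK_sum m x t :
  coshK (m + 1) x t + coshK (m - 1) x t = 2 * cosh t * coshK m x t.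
Proof.
have hp : (m + 1) * t = m * t + t by ring.
have hm : (m - 1) * t = m * t - t by ring.
rewrite /coshK hp hm; move: (expR (- (x * cosh t))) => E.
rewrite /cosh !opprD opprK !expRD !expRN.
by field; rewrite !gt_eqF ?expR_gt0.
Qed.

Lemma coshK_diff m x t :
  coshK (m + 1) x t - coshK (m - 1) x t =
  (expR t - expR (- t)) / 2 * (expK m x t - expK (- m) x t).
Proof.
have hp : (m + 1) * t = m * t + t by ring.
have hm : (m - 1) * t = m * t - t by ring.
rewrite /coshK /expK hp hm mulNr; move: (expR (- (x * cosh t))) => E.
rewrite /cosh !opprD opprK !expRD !expRN.
by field; rewrite !gt_eqF ?expR_gt0.
Qed.

Lemma besselK_parts m x : 0 < x ->
  m * besselK m x = x / 2 * (besselK (m + 1) x - besselK (m - 1) x).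
Proof.
move=> x0; apply/eqP; rewrite -subr_eq0; apply/eqP.
have im := coshK_integrable m x0.
have ip := coshK_integrable (m + 1) x0; have iq := coshK_integrable (m - 1) x0.
rewrite /besselK -RintegralB// -!RintegralZl//; last exact: integrable_subf.
have i1 := integrable_scalef m (measurable_itv _) im.
have i2 := integrable_scalef (x / 2) (measurable_itv _)
  (integrable_subf (measurable_itv _) ip iq).
rewrite -RintegralB//.
have i3 := integrable_subf (measurable_itv _) i1 i2.
have sub0 : `]0, +oo[%classic `<=` (`[0, +oo[%classic : set (measurableTypeR R)).
  by move=> t /=; rewrite !in_itv/= !andbT => /ltW.
have i4 := integrable_sub (measurable_itv _) (measurable_itv _) sub0 i3.
rewrite -Rintegral_itv_obnd_cbnd//.
(* [F] is exp(- x cosh t) sinh (m t), which vanishes at t = 0 and decays at infinity. *)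
pose F t := 2^-1 * (expK m x t - expK (- m) x t).
have dF t : is_derive t 1 F
   (m * coshK m x t - x / 2 * (coshK (m + 1) x t - coshK (m - 1) x t)).
  have ? := is_derive_expK m x t; have ? := is_derive_expK (- m) x t.
  by rewrite /F; derive_tac; rewrite coshK_diff coshKE; field.
have [C C0 hC] := expK_bound m x0; have [D D0 hD] := expK_bound (- m) x0.
apply: (@Rintegral_derive0 _ F) => //.
- move=> t _; apply: continuousB.
    by apply: continuousM; [exact: cst_continuous|exact: coshK_continuous].
  apply: continuousM; first exact: cst_continuous.
  by apply: continuousB; exact: coshK_continuous.
- have -> : 0 = F 0 by rewrite /F /expK !mulr0 subrr mulr0.
  exact: (cvg_comp _ _ (@cvg_harmonic R) (is_derive_continuous (dF 0))).
- apply/norm_cvg0P.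
  have h : (C + D) * n.+1%:R^-1 @[n --> \oo] --> 0.
    rewrite -[X in _ --> X](mulr0 (C + D)).
    by apply: cvgM; [exact: cvg_cst|exact: cvg_harmonic].
  apply: (squeeze_cvgr _ (cvg_cst 0) h); apply: nearW => n /=.
  rewrite normr_ge0/=; set t := n.+1%:R.
  have t0 : 0 < t by rewrite ltr0n.
  clearbody t.
  have := hC _ (ltW t0); have := hD _ (ltW t0).
  have e1 := expK_gt0 m x t; have e2 := expK_gt0 (- m) x t.
  have h3 : expR (- t) <= t^-1.
    rewrite expRN lef_pV2 ?posrE ?expR_gt0//.
    by have := expR_ge1Dx t; lra.
  have h4 := ler_wpM2l C0 h3; have h5 := ler_wpM2l D0 h3.
  by rewrite /F mulrDl ler_norml => h6 h7; apply/andP; split; lra.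
Qed.

Lemma is_derive_besselK m x : 0 < x ->
  is_derive x 1 (besselK m) (- (besselK (m + 1) x + besselK (m - 1) x) / 2).
Proof.
move=> x0.
have dk (y t : R) : is_derive y 1 (fun y => coshK m y t) (- cosh t * coshK m y t).
  by rewrite /coshK; derive_tac; ring.
have x2 : 0 < x / 2 by rewrite divr_gt0.
have Ix : `]x / 2, x + 1[%classic x by rewrite /= in_itv/=; apply/andP; split; lra.
have pos (y : R) : `]x / 2, x + 1[%classic y -> 0 < y.
  by rewrite /= in_itv/= => /andP[+ _]; exact: lt_trans.
(* The partial derivative decreases in absolute value as the argument grows, so its value at x / 2,
   the left end of the neighbourhood, is a majorant; by [coshK_sum] it is a sum of integrable
   functions. *)
pose G t := 2^-1 * (coshK (m + 1) (x / 2) t + coshK (m - 1) (x / 2) t).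
have GE t : G t = cosh t * coshK m (x / 2) t by rewrite /G coshK_sum; field.
have G0 t : 0 <= G t by rewrite GE mulr_ge0// ltW ?cosh_gt0 ?coshK_gt0.
have intf (y : R) : `]x / 2, x + 1[%classic y ->
    mu.-integrable `[0, +oo[ (EFin \o coshK m y).
  by move=> /pos; exact: coshK_integrable.
have derf (y t : R) : `]x / 2, x + 1[%classic y -> `[0, +oo[%classic t ->
    derivable (fun y => coshK m y t) y 1.
  by move=> _ _; have [] := dk y t.
have intG : mu.-integrable `[0, +oo[ (EFin \o G).
  apply: integrable_scalef => //.
  by apply: integrable_addf => //; exact: coshK_integrable.
have dE (y t : R) : partial1of2 (coshK m) y t = - cosh t * coshK m y t.
  by rewrite partial1of2E; have [] := dk y t.
have Gub (y t : R) : `]x / 2, x + 1[%classic y -> `[0, +oo[%classic t ->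
    `|partial1of2 (coshK m) y t| <= G t.
  move=> Iy _; rewrite dE mulNr normrN GE ger0_norm; last first.
    by rewrite mulr_ge0// ltW ?cosh_gt0 ?coshK_gt0.
  apply: ler_wpM2l; first exact: ltW (cosh_gt0 _).
  apply: ler_wpM2r; first exact: ltW (cosh_gt0 _).
  rewrite ler_expR lerN2; apply: ler_wpM2r; first exact: ltW (cosh_gt0 _).
  by move: Iy; rewrite /= in_itv/= => /andP[/ltW].
have mB : measurable (`[0, +oo[%classic : set (measurableTypeR R)) by [].
apply: DeriveDef.
  exact: (derivable_under_integral mB Ix intf derf G0 intG Gub).
rewrite -derive1E.
rewrite (differentiation_under_integral mB Ix intf derf G0 intG Gub).
have ip := coshK_integrable (m + 1) x0; have iq := coshK_integrable (m - 1) x0.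
transitivity (\int[mu]_(t in `[0, +oo[)
    (- 2^-1 * (coshK (m + 1) x t + coshK (m - 1) x t))).
  by apply: eq_Rintegral => t _; rewrite dE coshK_sum; field.
rewrite RintegralZl//; last exact: integrable_addf.
by rewrite RintegralD// mulNr mulrC -mulNr.
Qed.

(** Eliminating K_{m-1} through [besselK_parts] gives, with the next lemma, a closed first-order
    system in K_m and x K_{m+1}; no second derivative is ever taken. *)
Lemma theta_besselK m x : 0 < x ->
  is_derive x 1 (besselK m) ((m * besselK m x - x * besselK (m + 1) x) / x).
Proof.
move=> x0; apply: (is_derive_eq (is_derive_besselK m x0)).
rewrite besselK_parts//; move: (besselK (m + 1) x) (besselK (m - 1) x) => a b.
by field; rewrite gt_eqF.
Qed.

Lemma theta_besselKS m x : 0 < x ->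
  is_derive x 1 (fun x => x * besselK (m + 1) x)
    ((- m * (x * besselK (m + 1) x) - x ^+ 2 * besselK m x) / x).
Proof.
move=> x0; have ? := is_derive_besselK (m + 1) x0.
have := besselK_parts (m + 1) x0; rewrite addrK => h.
derive_tac; rewrite addrK.
move: (besselK (m + 1 + 1) x) (besselK (m + 1) x) (besselK m x) h => a b c h.
have -> : a = 2 / x * ((m + 1) * b) + c by rewrite h; field; rewrite gt_eqF.
by field; rewrite gt_eqF.
Qed.

Lemma besselK_decay m x : 1 <= x -> besselK m x <= expR (1 - x) * besselK m 1.
Proof.
move=> x1; have x0 : 0 < x by exact: lt_le_trans x1.
rewrite /besselK -RintegralZl//; last exact: coshK_integrable.
apply: le_Rintegral => //; first exact: coshK_integrable.
  by apply: integrable_scalef => //; exact: coshK_integrable.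
move=> t _; rewrite mulrA; apply: ler_wpM2r; first exact: ltW (cosh_gt0 _).
rewrite -expRD ler_expR.
have := ler_wpM2l (_ : 0 <= x - 1) (cosh_ge1 t); lra.
Qed.

End macdonald.

(** * The function I_nu through its power series in z = x^2 / 4 *)

Section bessel_first_kind.
Context {R : realType}.
Implicit Types (nu x z : R).

Definition coefI nu (k : nat) : R := (k`!%:R * Gamma (nu + k%:R + 1))^-1.

Definition sumI nu z : R := limn (pseries (coefI nu) z).

Lemma besselIE nu x : besselI nu x = (x / 2) `^ nu * sumI nu (x ^+ 2 / 4).
Proof.
rewrite /besselI /sumI /pseries; congr (_ * _).
by congr (lim (series _ @ \oo)); apply/funext => k; rewrite mulrC.
Qed.

Lemma Gamma_arg_gt0 nu (k : nat) : -1 < nu -> 0 < nu + k%:R + 1.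
Proof. by move=> nu1; have := ler0n R k; lra. Qed.

Lemma coefI_gt0 nu k : -1 < nu -> 0 < coefI nu k.
Proof.
move=> nu1; rewrite invr_gt0 mulr_gt0 ?ltr0n ?fact_gt0//.
exact/Gamma_gt0/Gamma_arg_gt0.
Qed.

Lemma coefI_rec nu k : -1 < nu ->
  coefI nu k = (nu + 1 + k%:R) * coefI (nu + 1) k.
Proof.
move=> nu1; have g0 := Gamma_arg_gt0 k nu1.
rewrite /coefI (_ : nu + 1 + k%:R + 1 = nu + k%:R + 1 + 1); last by ring.
rewrite (GammaS g0) (_ : nu + 1 + k%:R = nu + k%:R + 1); last by ring.
have := Gamma_gt0 g0; move: (Gamma _) => g gg.
have f0 : 0 < k`!%:R :> R by rewrite ltr0n fact_gt0.
by field; rewrite !gt_eqF.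
Qed.

(** The factor k + 1 cancels against (k + 1)!, and nu + (k + 1) + 1 is the Gamma argument of index k
    for the order nu + 1. *)
Lemma pseries_diffs_coefI nu : pseries_diffs (coefI nu) = coefI (nu + 1).
Proof.
apply/funext => k; rewrite /pseries_diffs /coefI factS natrM.
rewrite (_ : nu + k.+1%:R + 1 = nu + 1 + k%:R + 1); last by rewrite -natr1; ring.
by rewrite -mulrA [in LHS]invfM mulVKf// pnatr_eq0.
Qed.

(** In Gamma (u + 1) = u Gamma u only the first factor nu + 1 can be less than 1, whence the minimum
    in the constant; later factors exceed 1. The bound lets the exponential series dominate that of
    I_nu. *)
Lemma Gamma_lower_bound nu : -1 < nu ->
  exists2 c : R, 0 < c & forall k : nat, c <= Gamma (nu + k%:R + 1).
Proof.
move=> nu1; have g0 := Gamma_arg_gt0 0 nu1; rewrite addr0 in g0.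
have G0 := Gamma_gt0 g0.
exists (Num.min 1 (nu + 1) * Gamma (nu + 1)).
  by rewrite mulr_gt0// lt_min ltr01.
elim=> [|k IH].
  by rewrite addr0 ler_piMl ?(ltW G0)// ge_min lexx.
rewrite (_ : nu + k.+1%:R + 1 = nu + k%:R + 1 + 1); last by rewrite -natr1; ring.
rewrite (GammaS (Gamma_arg_gt0 k nu1)); case: k IH => [|k] IH.
  by rewrite addr0 ler_wpM2r ?(ltW G0)// ge_min lexx orbT.
apply: (le_trans IH); apply: ler_peMl.
  exact/ltW/Gamma_gt0/Gamma_arg_gt0.
by have := ler0n R k; rewrite -natr1; lra.
Qed.

Lemma coefI_is_cvg nu z : -1 < nu -> cvgn (pseries (coefI nu) z).
Proof.
move=> nu1; have [c c0 hc] := Gamma_lower_bound nu1.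
apply: normed_cvg; rewrite /normed_series_of/=.
apply: (@series_le_cvg _ _ (fun k => c^-1 * exp_coeff `|z| k)).
- by move=> k; exact: normr_ge0.
- move=> k; rewrite mulr_ge0 ?invr_ge0 ?(ltW c0)//.
  by rewrite divr_ge0 ?exprn_ge0.
- move=> k; rewrite normrM normrX gtr0_norm ?coefI_gt0//.
  rewrite /exp_coeff/= mulrCA mulrC; apply: ler_wpM2l; first exact: exprn_ge0.
  rewrite /coefI invfM mulrC; apply: ler_wpM2r; first by rewrite invr_ge0.
  by rewrite lef_pV2 ?posrE ?Gamma_gt0 ?Gamma_arg_gt0.
- by apply: is_cvg_seriesZ; exact: is_cvg_series_exp_coeff.
Qed.

Lemma is_derive_sumI nu z : -1 < nu ->
  is_derive z 1 (sumI nu) (sumI (nu + 1) z).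
Proof.
move=> nu1.
have nu2 : -1 < nu + 1 by lra.
have nu3 : -1 < nu + 1 + 1 by lra.
rewrite /sumI -pseries_diffs_coefI.
apply: (@pseries_snd_diffs _ _ (`|z| + 1)); rewrite ?pseries_diffs_coefI.
- exact: coefI_is_cvg.
- exact: coefI_is_cvg.
- exact: coefI_is_cvg.
- by rewrite [ltRHS]ger0_norm ?addr_ge0// ltrDl.
Qed.

Lemma sumI0 nu : sumI nu 0 = (Gamma (nu + 1))^-1.
Proof.
rewrite /sumI; apply/cvg_lim => //; apply: cvg_near_cst; near=> n.
have n0 : (0 < n)%N by near: n; exists 1%N.
rewrite /pseries /series/= -(prednK n0) big_nat_recl//= big1 ?addr0.
  by rewrite expr0 mulr1 /coefI fact0 mul1r addr0.
by move=> i _; rewrite exprS mul0r mulr0.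
Unshelve. all: by end_near. Qed.

Lemma sumI_gt0 nu z : -1 < nu -> 0 <= z -> 0 < sumI nu z.
Proof.
move=> nu1 z0; apply: (@lt_le_trans _ _ (pseries (coefI nu) z 1)).
  by rewrite /pseries /series/= big_nat1 expr0 mulr1 coefI_gt0.
have nd : nondecreasing_seq (pseries (coefI nu) z).
  apply/nondecreasing_seqP => n.
  rewrite /pseries /series/= big_nat_recr//= lerDl.
  by rewrite mulr_ge0 ?exprn_ge0// ltW// coefI_gt0.
exact: (nondecreasing_cvgn_le nd (coefI_is_cvg nu1) 1%N).
Qed.

(** By [coefI_rec] each coefficient splits into an (nu + 1) part and a k part, the latter giving z
    times a derivative. As differentiation raises the order, this is Bessel's equation z f'' + (nu +
    1) f' = f for f = [sumI nu]. *)
Lemma sumI_rec nu z : -1 < nu ->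
  sumI nu z = (nu + 1) * sumI (nu + 1) z + z * sumI (nu + 1 + 1) z.
Proof.
move=> nu1.
have nu2 : -1 < nu + 1 by lra.
have nu3 : -1 < nu + 1 + 1 by lra.
have h : cvgn (pseries (pseries_diffs (coefI (nu + 1))) z).
  by rewrite pseries_diffs_coefI; exact: coefI_is_cvg.
have := pseries_diffs_equiv h; rewrite /= pseries_diffs_coefI -/(sumI _ _) => h1.
have h2 : pseries (coefI (nu + 1)) z @ \oo --> sumI (nu + 1) z.
  exact: coefI_is_cvg.
rewrite {1}/sumI; apply/cvg_lim => //.
have -> : pseries (coefI nu) z = fun n =>
    (nu + 1) * pseries (coefI (nu + 1)) z n +
    z * series (fun i : nat => i%:R * coefI (nu + 1) i * z ^+ i.-1) n.
  apply/funext => n; rewrite /pseries /series/= !mulr_sumr -big_split/=.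
  apply: eq_bigr => -[|i] _; rewrite (coefI_rec _ nu1).
    by rewrite /= !expr0; ring.
  by rewrite /= exprS; ring.
apply: cvgD; first by apply: cvgM; [exact: cvg_cst|exact: h2].
by apply: cvgM; [exact: cvg_cst|exact: h1].
Qed.

Lemma besselI_gt0 nu x : -1 < nu -> 0 < x -> 0 < besselI nu x.
Proof.
move=> nu1 x0; rewrite besselIE mulr_gt0 ?powR_gt0 ?divr_gt0//.
by apply: sumI_gt0 => //; rewrite divr_ge0// sqr_ge0.
Qed.

Lemma besselIS nu x : 0 < x ->
  x * besselI (nu + 1) x = (x / 2) `^ nu * (x ^+ 2 / 2 * sumI (nu + 1) (x ^+ 2 / 4)).
Proof.
move=> x0; have x2 : 0 < x / 2 by rewrite divr_gt0.
rewrite besselIE powRD; last by rewrite (gt_eqF x2) implybT.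
by rewrite powRr1 ?ltW//; field.
Qed.

Lemma theta_besselI nu x : -1 < nu -> 0 < x ->
  is_derive x 1 (besselI nu) ((nu * besselI nu x + x * besselI (nu + 1) x) / x).
Proof.
move=> nu1 x0; have x2 : 0 < x / 2 by rewrite divr_gt0.
have -> : besselI nu = fun x => (x / 2) `^ nu * sumI nu (x ^+ 2 / 4).
  by apply/funext => y; rewrite besselIE.
have dx : is_derive x 1 (fun x : R => x ^+ 2 / 4) (x / 2).
  by derive_tac; field.
have ds := @is_derive1_comp _ (sumI nu) (fun x : R => x ^+ 2 / 4) _ _ _
  (is_derive_sumI _ nu1) dx.
have dp : is_derive x 1 (fun x : R => (x / 2) `^ nu) (nu * (x / 2) `^ nu / x).
  derive_tac; rewrite powRB; last by rewrite (gt_eqF x2) implybT.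
  by rewrite powRr1 ?ltW//; field; rewrite gt_eqF.
eapply is_derive_eq; first exact: (is_derive_mulf dp ds).
rewrite /= besselIS//; move: (_ `^ _) (sumI nu _) (sumI (nu + 1) _) => a b c.
by field; rewrite gt_eqF.
Qed.

Lemma theta_besselIS nu x : -1 < nu -> 0 < x ->
  is_derive x 1 (fun x => x * besselI (nu + 1) x)
    ((- nu * (x * besselI (nu + 1) x) + x ^+ 2 * besselI nu x) / x).
Proof.
move=> nu1 x0; have nu2 : -1 < nu + 1 by lra.
have dI := theta_besselI nu2 x0.
eapply is_derive_eq; first exact: (is_derive_mulf (is_derive_idf x) dI).
have x2 : 0 < x / 2 by rewrite divr_gt0.
have hp a : (x / 2) `^ (a + 1) = (x / 2) `^ a * (x / 2).
  rewrite powRD; last by rewrite (gt_eqF x2) implybT.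
  by rewrite powRr1 ?ltW.
rewrite /= !besselIE (sumI_rec _ nu1) !hp.
move: (_ `^ _) (sumI (nu + 1) _) (sumI (nu + 1 + 1) _) => a b c.
by field; rewrite gt_eqF.
Qed.

Lemma besselIS_gt0 nu x : -1 < nu -> 0 < x -> 0 < x * besselI (nu + 1) x.
Proof. by move=> nu1 x0; rewrite mulr_gt0// besselI_gt0//; lra. Qed.

(** Multiplying [sumI_rec] by x^2 / (2 (nu + 1)) and dropping the nonnegative last term gives the
    bound. It means theta I / I <= nu + x^2 / (2 (nu + 1)), the starting estimate of the comparison
    near 0. *)
Lemma besselIS_le nu x : -1 < nu -> 0 < x ->
  x * besselI (nu + 1) x <= x ^+ 2 / (2 * (nu + 1)) * besselI nu x.
Proof.
move=> nu1 x0; have z0 : 0 <= x ^+ 2 / 4 by rewrite divr_ge0// sqr_ge0.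
have nu3 : -1 < nu + 1 + 1 by lra.
rewrite besselIS// besselIE [leRHS]mulrCA; apply: ler_wpM2l; first exact: powR_ge0.
rewrite (sumI_rec _ nu1); have := sumI_gt0 nu3 z0; set a := sumI (nu + 1) _.
move: (sumI _ _) => b b0.
have -> : x ^+ 2 / (2 * (nu + 1)) * ((nu + 1) * a + x ^+ 2 / 4 * b) =
   x ^+ 2 / 2 * a + x ^+ 2 / (2 * (nu + 1)) * (x ^+ 2 / 4 * b).
  by field; rewrite gt_eqF//; lra.
rewrite lerDl !mulr_ge0// ?sqr_ge0 ?invr_ge0 ?(ltW b0)//; lra.
Qed.

End bessel_first_kind.

(** * Behaviour of K at 0 and the value of the Wronskian *)

Section wronskian.
Context {R : realType}.
Notation mu := (@lebesgue_measure R).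
Implicit Types (m nu x d : R).

Definition gammaK m x : R := x `^ (m - 1) * expR (- x).

Definition tailGamma m x : R := \int[mu]_(u in `[x, +oo[) gammaK m u.

Definition halfK m x : R := \int[mu]_(t in `[0, +oo[) expK m x t.

Lemma expK_ge0 m x t : 0 <= expK m x t.
Proof. exact/ltW/expK_gt0. Qed.

Lemma gammaK_ge0 m x : 0 <= gammaK m x.
Proof. by rewrite mulr_ge0 ?powR_ge0 ?expR_ge0. Qed.

Lemma gammaK_integrable m d : 0 < m -> 0 < d ->
  mu.-integrable `[d, +oo[ (EFin \o gammaK m).
Proof.
move=> m0 d0; apply: integrable_sub (Gamma_integrable m0) => //.
by move=> t /=; rewrite !in_itv/= !andbT; exact: lt_le_trans.
Qed.

Lemma gammaK_exp_integrable m d : 0 < m -> 0 < d ->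
  mu.-integrable `[d, +oo[ (EFin \o (fun u => gammaK m u * expR (- (d ^+ 2 / u)))).
Proof.
move=> m0 d0; apply: le_integrable (gammaK_integrable m0 d0) => //.
  apply: measurable_funS (@continuous_pos_measurable _ _ _) => //.
    by move=> t /=; rewrite !in_itv/= !andbT; exact: lt_le_trans.
  move=> t t0; have tn : t != 0 by rewrite gt_eqF.
  by rewrite /gammaK; eapply is_derive_continuous; repeat derive_step.
move=> t /=; rewrite in_itv/= andbT => dt; have t0 := lt_le_trans d0 dt.
rewrite lee_fin normrM ler_piMr ?normr_ge0// ger0_norm ?expR_ge0//.
by rewrite expR_le1 oppr_le0 divr_ge0 ?sqr_ge0// ltW.
Qed.

(* The substitution t = ln (u / d) turns 2 d cosh t into u + d^2 / u. *)
Lemma expK_substitution m d : 0 < m -> 0 < d ->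
  d `^ m * halfK m (2 * d) =
  \int[mu]_(u in `[d, +oo[) (gammaK m u * expR (- (d ^+ 2 / u))).
Proof.
move=> m0 d0; pose F u : R := ln (u / d).
have dF (u : R) : 0 < u -> is_derive u 1 F u^-1.
  move=> u0; have ud : 0 < u / d by rewrite divr_gt0.
  have h1 : is_derive u 1 (fun u : R => u / d) d^-1 by derive_tac; ring.
  apply: (is_derive_eq (@is_derive1_comp _ (@ln R) (fun u => u / d) _ _ _
    (is_derive1_ln ud) h1)).
  by field; rewrite !gt_eqF.
have dFE (u : R) : 0 < u -> F^`()%classic u = u^-1.
  by move=> u0; rewrite derive1E; have [] := dF _ u0.
have cV (u : R) : 0 < u -> {for u, continuous (fun u : R => u^-1)}.
  by move=> u0; apply: continuousV; rewrite ?gt_eqF//; exact: cvg_id.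
have Fd : F d = 0 by rewrite /F divff ?gt_eqF// ln1.
have sub := @increasing_ge0_integration_by_substitutiony _ F (expK m (2 * d)) d.
rewrite Fd in sub.
have {}sub : (\int[mu]_(t in `[0%R, +oo[) (expK m (2 * d) t)%:E =
    \int[mu]_(u in `[d, +oo[) ((((expK m (2 * d) \o F) * F^`()%classic)%R u)%:E))%E.
  apply: sub.
  - move=> u v; rewrite !in_itv/= !andbT => du dv uv.
    have u0 := lt_le_trans d0 du; have v0 := lt_le_trans d0 dv.
    by rewrite /F ltr_ln ?posrE ?divr_gt0// ltr_pM2r// invr_gt0.
  - move=> u; rewrite in_itv/= andbT => du; have u0 := lt_trans d0 du.
    rewrite /continuous_at dFE//.
    apply: cvg_trans (cV u u0); apply: near_eq_cvg; near=> v.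
    by rewrite dFE//; near: v; exact: lt_nbhsr.
  - apply/cvg_ex; exists d^-1 => /=.
    apply: cvg_trans (cvg_at_right_filter (cV d d0)).
    apply: near_eq_cvg; near=> v; rewrite dFE//.
    by apply: (lt_trans d0); near: v; exact: nbhs_right_gt.
  - apply/cvg_ex; exists 0 => /=.
    apply/cvgrPdist_lt => e e0; near=> u.
    have eu : e^-1 < u by near: u; apply: nbhs_pinfty_gt; rewrite num_real.
    have u0 : 0 < u by apply: lt_trans eu; rewrite invr_gt0.
    rewrite dFE// sub0r normrN gtr0_norm ?invr_gt0// -(invrK e).
    by rewrite ltf_pV2 ?posrE ?invr_gt0.
  - split; last by apply: cvg_at_right_filter; exact: is_derive_continuous (dF _ d0).
    move=> u; rewrite in_itv/= andbT => du.
    by have [] := dF _ (lt_trans d0 du).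
  - apply/cvgryPge => A; near=> u.
    have h : d * expR A <= u by near: u; apply: nbhs_pinfty_ge; rewrite num_real.
    rewrite -[leLHS]expRK /F ler_ln ?posrE ?expR_gt0//.
      by rewrite ler_pdivlMr// mulrC.
    by rewrite divr_gt0// (lt_le_trans _ h)// mulr_gt0// expR_gt0.
  - by apply: continuous_subspaceT; exact: expK_continuous.
  - by move=> t _; exact/ltW/expK_gt0.
have -> : halfK m (2 * d) =
    \int[mu]_(u in `[d, +oo[) ((expK m (2 * d) \o F) * F^`()%classic) u.
  by rewrite /halfK /Rintegral sub.
have key (u : R) : d <= u -> expK m (2 * d) (F u) * u^-1 =
    d `^ (- m) * (gammaK m u * expR (- (d ^+ 2 / u))).
  move=> du.
  have u0 := lt_le_trans d0 du; have ud : 0 < u / d by rewrite divr_gt0.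
  rewrite /expK /gammaK /F /cosh (expRN (ln _)) lnK ?posrE//.
  have -> : - (2 * d * ((u / d + (u / d)^-1) / 2)) = - u + - (d ^+ 2 / u).
    by field; rewrite !gt_eqF.
  rewrite expRD powRN.
  have -> : expR (m * ln (u / d)) = u `^ m / d `^ m.
    by rewrite /powR !gt_eqF// -expRN -expRD; congr expR; rewrite ln_div//; ring.
  have -> : u `^ (m - 1) = u `^ m / u.
    by rewrite powRB ?(gt_eqF u0) ?implybT// powRr1// ltW.
  by field; rewrite !gt_eqF ?powR_gt0.
transitivity (d `^ m * \int[mu]_(u in `[d, +oo[)
    (d `^ (- m) * (gammaK m u * expR (- (d ^+ 2 / u))))).
  congr (_ * _); apply: eq_Rintegral => u /set_mem/=; rewrite in_itv/= andbT => du.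
  by rewrite !fctE dFE ?(lt_le_trans d0 du)//; exact: key.
rewrite RintegralZl//; last exact: gammaK_exp_integrable.
by rewrite mulrA powRN divff ?mul1r// gt_eqF// powR_gt0.
Unshelve. all: by end_near. Qed.

(** After the substitution, exp(- d^2 / u) <= 1. For the companion lower bound, d^2 / u <= d on u >=
    d; the two squeeze d^m [halfK m (2 * d)] towards Gamma m. *)
Lemma expK_upper m d : 0 < m -> 0 < d ->
  d `^ m * halfK m (2 * d) <= Gamma m.
Proof.
move=> m0 d0; rewrite expK_substitution//.
apply: (@le_trans _ _ (tailGamma m d)).
  apply: le_Rintegral => //.
  - exact: gammaK_exp_integrable.
  - exact: gammaK_integrable.
  move=> t /=; rewrite in_itv/= andbT => dt; have t0 := lt_le_trans d0 dt.
  rewrite ler_piMr ?gammaK_ge0//.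
  by rewrite expR_le1 oppr_le0 divr_ge0 ?sqr_ge0// ltW.
have i0 := Gamma_integrable m0.
rewrite /Gamma /Rintegral; apply: fine_le.
- by apply: (integrable_fin_num _ (gammaK_integrable m0 d0)).
- by apply: (integrable_fin_num _ i0).
apply: ge0_subset_integral => //.
- exact: measurable_int i0.
- by move=> t _; rewrite lee_fin; exact: gammaK_ge0.
- by move=> t /=; rewrite !in_itv/= !andbT; exact: lt_le_trans.
Qed.

Lemma expK_lower m d : 0 < m -> 0 < d ->
  expR (- d) * tailGamma m d <=
  d `^ m * halfK m (2 * d).
Proof.
move=> m0 d0; rewrite expK_substitution// -RintegralZl//; last first.
  exact: gammaK_integrable.
apply: le_Rintegral => //.
- by apply: integrable_scalef => //; exact: gammaK_integrable.
- exact: gammaK_exp_integrable.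
move=> t /=; rewrite in_itv/= andbT => dt; have t0 := lt_le_trans d0 dt.
rewrite mulrC; apply: ler_wpM2l; first exact: gammaK_ge0.
rewrite ler_expR lerN2 ler_pdivrMr// expr2.
by apply: ler_wpM2l => //; exact: ltW.
Qed.

Lemma le_expK m m' x : 0 < x -> m <= m' ->
  halfK m x <= halfK m' x.
Proof.
move=> x0 mm; apply: le_Rintegral => //; [exact: expK_integrable..|].
move=> t /=; rewrite in_itv/= andbT => t0.
apply: ler_wpM2l; first exact: expR_ge0.
by rewrite ler_expR ler_wpM2r.
Qed.

(** Brings orders of either sign within reach of [expK_upper], which asks for a positive order. *)
Lemma besselK_le m m' x : 0 < x -> `|m| <= m' ->
  besselK m x <= halfK m' x.
Proof.
move=> x0; rewrite ler_norml => /andP[h1 h2].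
rewrite besselK_expK// -/(halfK m x) -/(halfK (- m) x).
have := le_expK x0 h2; have := @le_expK (- m) m' x x0.
rewrite lerNl => /(_ h1); move: (halfK _ _) (halfK m x) (halfK m' x) => a b c.
lra.
Qed.

Let sinv (n : nat) : R := n.+1%:R^-1.

Let sinv_gt0 n : 0 < sinv n.
Proof. by rewrite invr_gt0. Qed.

Let cvg_sinv : sinv n @[n --> \oo] --> 0.
Proof. exact: cvg_harmonic. Qed.

Lemma cvg_besselK0 m : 0 < m ->
  sinv n `^ m * besselK m (2 * sinv n) @[n --> \oo] --> Gamma m / 2.
Proof.
move=> m0.
have m2 : 0 < m / 2 by rewrite divr_gt0.
have lo : expR (- sinv n) * (tailGamma m (sinv n)) / 2
    @[n --> \oo] --> Gamma m / 2.
  rewrite -[Gamma m]mul1r -[X in X * Gamma m]expR0 -[X in expR X]oppr0.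
  apply: cvgM; last exact: cvg_cst.
  apply: cvgM.
    have d0 : is_derive (0 : R) 1 (fun t : R => expR (- t)) (expR (- 0) * - 1).
      by repeat derive_step.
    exact: (cvg_comp _ _ cvg_sinv (is_derive_continuous d0)).
  apply: (@cvg_Rintegral_exhaust _ `]0, +oo[ (fun n => `[sinv n, +oo[%classic)).
  - by [].
  - by move=> n.
  - by move=> n t /=; rewrite !in_itv/= !andbT; exact: lt_le_trans.
  - move=> t /=; rewrite in_itv/= andbT => t0; near=> n.
    rewrite /= in_itv/= andbT; apply: ltW.
    by near: n; exact: (near_infty_natSinv_lt (PosNum t0)).
  - exact: Gamma_integrable.
(* The half of order - m is negligible: it is at most [halfK (m / 2)], hence O(d^(- m / 2)), so
   after multiplication by d^m it is O(d^(m / 2)). *)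
have up : Gamma m / 2 + sinv n `^ (m / 2) * (Gamma (m / 2) / 2)
    @[n --> \oo] --> Gamma m / 2.
  rewrite -[X in _ --> X]addr0 -[X in _ --> _ + X](mul0r (Gamma (m / 2) / 2)).
  apply: cvgD; first exact: cvg_cst.
  by apply: cvgM; [exact: cvg_powR_natSinv|exact: cvg_cst].
apply: (squeeze_cvgr _ lo up); apply: nearW => n.
have d0 := sinv_gt0 n; move: (sinv n) d0 => d d0.
have x0 : 0 < 2 * d by rewrite mulr_gt0.
have p0 := powR_gt0 m d0; have q0 := powR_gt0 (m / 2) d0.
rewrite besselK_expK// -/(halfK m _) -/(halfK (- m) _).
have h1 := expK_lower m0 d0; have h2 := expK_upper m0 d0.
have h3 := expK_upper m2 d0.
have h4 : halfK (- m) (2 * d) <=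
    halfK (m / 2) (2 * d) by apply: le_expK => //; clear -m0; lra.
have h5 : 0 <= halfK (- m) (2 * d).
  by apply: Rintegral_ge0 => t _; exact: expK_ge0.
have E : d `^ m = d `^ (m / 2) * d `^ (m / 2).
  rewrite -powRD; last by rewrite (gt_eqF d0) implybT.
  by congr powR; field.
have h6 := ler_wpM2l (ltW p0) h4; have h7 := ler_wpM2l (ltW q0) h3.
have h8 := mulr_ge0 (ltW p0) h5.
rewrite mulrA -E in h7.
move: (halfK _ _) (halfK (- m) _) (halfK _ _) (Gamma _) (Gamma (m / 2))
  (tailGamma _ _) (d `^ m) (d `^ (m / 2)) (expR _) h1 h2 h6 h7 h8.
by clear; move=> *; apply/andP; split; lra.
Unshelve. all: by end_near. Qed.

Lemma theta_wronskian nu x : -1 < nu -> 0 < x ->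
  is_derive x 1 (fun x => besselI nu x * (x * besselK (nu + 1) x) +
    (x * besselI (nu + 1) x) * besselK nu x) 0.
Proof.
move=> nu1 x0.
have dP := theta_besselI nu1 x0; have dS := theta_besselIS nu1 x0.
have dK := theta_besselK nu x0; have dT := theta_besselKS nu x0.
eapply is_derive_eq.
  exact: (is_derive_addf (is_derive_mulf dP dT) (is_derive_mulf dS dK)).
rewrite /=.
move: (besselI nu x) (besselI (nu + 1) x) (besselK nu x) (besselK (nu + 1) x).
by move=> a b c e; field; rewrite gt_eqF.
Qed.

(** The expression is constant, so it equals its limit along x = 2 / (n + 1). There the first
    product tends to 2 (1 / Gamma (nu + 1)) (Gamma (nu + 1) / 2) = 1 and the second to 0. *)
Lemma wronskian nu x : -1 < nu -> 0 < x ->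
  besselI nu x * (x * besselK (nu + 1) x) +
    (x * besselI (nu + 1) x) * besselK nu x = 1.
Proof.
move=> nu1 x0.
pose W x := besselI nu x * (x * besselK (nu + 1) x) +
    (x * besselI (nu + 1) x) * besselK nu x.
have dW (y : R) : 0 < y -> is_derive y 1 W 0 by move=> y0; exact: theta_wronskian.
have Wle (a b : R) : 0 < a -> a <= b -> W a = W b.
  move=> a0 ab; apply: is_derive0_eq => // y /andP[ay _].
  exact/dW/(lt_le_trans a0).
have Weq (a b : R) : 0 < a -> 0 < b -> W a = W b.
  by move=> a0 b0; have [ab|/ltW ba] := leP a b; [|symmetry]; apply: Wle.
suff h : W (2 * sinv n) @[n --> \oo] --> (1 : R).
  apply: (cvg_unique _ _ h) => //; rewrite -/(W x).
  apply: cvg_near_cst; apply: nearW => n; apply: Weq => //.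
  by rewrite mulr_gt0.
have nu2 : 0 < nu + 1 by lra.
have nu3 : -1 < nu + 1 by lra.
have g0 := Gamma_gt0 nu2.
(* With |nu| < m, K_nu (2 d) is O(d^(-m)), and with m < nu + 2 the product d^(nu + 2) K_nu (2 d)
   tends to 0. Such an m exists because nu > -1. *)
pose m := (`|nu| + (nu + 2)) / 2.
have [nm mn] : `|nu| < m /\ m < nu + 2.
  have : `|nu| < nu + 2 by rewrite ltr_norml; apply/andP; split; lra.
  by rewrite /m; split; lra.
have m0 : 0 < m by have := normr_ge0 nu; lra.
have cs (a : R) : -1 < a -> sumI a (sinv n ^+ 2) @[n --> \oo] --> sumI a 0.
  move=> a1; rewrite -[X in sumI a X](expr0n R 2).
  have ds := @is_derive_sumI _ a (0 ^+ 2) a1.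
  have d2 : is_derive (0 : R) 1 (fun t : R => t ^+ 2) (2 * 0 * 1).
    by repeat derive_step.
  have s2 := cvg_comp _ _ cvg_sinv (is_derive_continuous d2).
  exact: (cvg_comp _ _ s2 (is_derive_continuous ds)).
have h1 : 2 * (sumI nu (sinv n ^+ 2) *
    (sinv n `^ (nu + 1) * besselK (nu + 1) (2 * sinv n))) @[n --> \oo] --> (1 : R).
  have E1 : 2 * ((Gamma (nu + 1))^-1 * (Gamma (nu + 1) / 2)) = 1.
    by field; rewrite gt_eqF.
  rewrite -[X in _ --> X]E1.
  apply: cvgM; first exact: cvg_cst.
  by apply: cvgM; [rewrite -sumI0; exact: cs|exact: cvg_besselK0].
have h2 : 2 * (sumI (nu + 1) (sinv n ^+ 2) * (sinv n `^ (nu + 2 - m) * Gamma m))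
    @[n --> \oo] --> (0 : R).
  have E2 : 2 * (sumI (nu + 1) 0 * (0 * Gamma m)) = 0 by ring.
  rewrite -[X in _ --> X]E2.
  apply: cvgM; first exact: cvg_cst.
  apply: cvgM; first exact: cs.
  by apply: cvgM; [apply: cvg_powR_natSinv; lra|exact: cvg_cst].
have h3 := cvgD h1 h2; rewrite addr0 in h3.
apply: (squeeze_cvgr _ h1 (h3 _)); apply: nearW => n /=.
have d0 := sinv_gt0 n; rewrite !fctE; move: (sinv n) d0 => d d0.
have x2 : 0 < 2 * d by rewrite mulr_gt0.
have WE : W (2 * d) =
    2 * (sumI nu (d ^+ 2) * (d `^ (nu + 1) * besselK (nu + 1) (2 * d))) +
    2 * (sumI (nu + 1) (d ^+ 2) * (d `^ (nu + 2) * besselK nu (2 * d))).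
  have e1 : 2 * d / 2 = d by field.
  have e2 : (2 * d) ^+ 2 / 4 = d ^+ 2 by field.
  have e3 : d `^ (nu + 1) = d `^ nu * d.
    by rewrite powRD ?(gt_eqF d0) ?implybT// powRr1// ltW.
  have e4 : d `^ (nu + 2) = d `^ nu * d * d.
    rewrite (_ : nu + 2 = nu + 1 + 1); last by ring.
    by rewrite powRD ?(gt_eqF d0) ?implybT// e3 powRr1// ltW.
  rewrite /W (besselIE nu) (besselIE (nu + 1)) e1 e2 e4 e3.
  move: (besselK (nu + 1) _) (besselK nu _) (sumI nu _) (sumI (nu + 1) _) => *.
  ring.
rewrite WE lerDl lerD2l; apply/andP; split.
  rewrite mulr_ge0// mulr_ge0 ?mulr_ge0 ?powR_ge0 ?(ltW (besselK_gt0 _ _))//.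
  by apply/ltW/sumI_gt0 => //; exact: sqr_ge0.
apply: ler_wpM2l => //; apply: ler_wpM2l.
  by apply/ltW/sumI_gt0 => //; exact: sqr_ge0.
have -> : d `^ (nu + 2) = d `^ (nu + 2 - m) * d `^ m.
  by rewrite -powRD ?(gt_eqF d0) ?implybT// subrK.
rewrite -mulrA; apply: ler_wpM2l; first exact: powR_ge0.
apply: le_trans (expK_upper m0 d0); apply: ler_wpM2l; first exact: powR_ge0.
by apply: besselK_le => //; exact: ltW.
Qed.

End wronskian.

(** * Sign propagation for theta, and smallness of x exp(-x) *)

Section growth.
Context {R : realType}.
Implicit Types (x z u : R) (D A : R -> R).

Lemma gronwall_theta D (dD : R -> R) A a b : 0 < a -> a <= b ->
  (forall x, 0 < x -> {for x, continuous A}) ->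
  (forall x, 0 < x -> is_derive x 1 D (dD x / x)) ->
  (forall x, 0 < x -> dD x + A x * D x <= 0) ->
  D a < 0 -> D b < 0.
Proof.
move=> a0 ab cA dDE dD0.
apply: (@gronwall_lt0 _ D (fun x => dD x / x) (fun x => A x / x)) => //.
  move=> x x0; apply: continuousM; first exact: cA.
  by apply: continuousV; rewrite ?gt_eqF//; exact: cvg_id.
by move=> x x0; rewrite mulrAC -mulrDl mulr_le0_ge0 ?dD0// invr_ge0 ltW.
Qed.

Lemma linear_expRN_small (C e x0 : R) : 0 <= C -> 0 < e ->
  exists2 x : R, 1 <= x /\ x0 <= x & C * x * expR (1 - x) < e.
Proof.
move=> C0 e0.
have K0 : 0 <= 4 * expR 1 * C / e by rewrite !mulr_ge0 ?invr_ge0 ?expR_ge0// ltW.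
(* From exp x >= x^2 / 4, C x exp(1 - x) <= 4 exp(1) C / x, which the last summand pushes below
   e. *)
exists (1 + `|x0| + 4 * expR 1 * C / e).
  by have := ler_norm x0; have := normr_ge0 x0; split; lra.
set x := 1 + _ + _.
have x1 : 0 < x by rewrite /x; have := normr_ge0 x0; lra.
have h : x ^+ 2 / 4 <= expR x.
  have -> : expR x = expR (x / 2) ^+ 2 by rewrite -expRM_natl; congr expR; field.
  have := expR_ge1Dx (x / 2); have -> : x ^+ 2 / 4 = (x / 2) ^+ 2 by field.
  by move=> h; rewrite lerXn2r ?nnegrE ?expR_ge0//; lra.
have xe : 4 * expR 1 * C < e * x.
  have : 4 * expR 1 * C / e < x by rewrite /x; have := normr_ge0 x0; lra.
  by rewrite ltr_pdivrMr// [x * e]mulrC.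
rewrite expRD expRN mulrA ltr_pdivrMr ?expR_gt0//.
apply: lt_le_trans (ler_wpM2l (ltW e0) h).
have := ltr_pM2r (x := x / 4) (_ : 0 < x / 4); rewrite divr_gt0// => /(_ isT).
move=> /(_ (4 * expR 1 * C) (e * x)); rewrite xe => hh.
have {}hh : 4 * expR 1 * C * (x / 4) < e * x * (x / 4) by rewrite hh.
have -> : e * (x ^+ 2 / 4) = e * x * (x / 4) by field.
by have -> : C * x * expR 1 = 4 * expR 1 * C * (x / 4) by field.
Qed.

End growth.

(** * Riccati comparison; [P], [S], [K], [T] stand for I_nu, x I_{nu+1}, K_nu, x K_{nu+1} *)

Section comparison.
Context {R : realType} (nu C : R) (P S K T : R -> R).
Implicit Types (x z u : R) (A B y al : R -> R).

Hypotheses (nu1 : -1 < nu) (C_ge0 : 0 <= C).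
Hypotheses (P_gt0 : forall x, 0 < x -> 0 < P x)
  (S_gt0 : forall x, 0 < x -> 0 < S x)
  (S_le : forall x, 0 < x -> S x <= x ^+ 2 / (2 * (nu + 1)) * P x)
  (K_gt0 : forall x, 0 < x -> 0 < K x) (T_gt0 : forall x, 0 < x -> 0 < T x)
  (K_decay : forall x, 1 <= x -> K x <= C * expR (1 - x))
  (T_decay : forall x, 1 <= x -> T x <= C * x * expR (1 - x)).
Hypotheses
  (dP : forall x, 0 < x -> is_derive x 1 P ((nu * P x + S x) / x))
  (dS : forall x, 0 < x -> is_derive x 1 S ((- nu * S x + x ^+ 2 * P x) / x))
  (dK : forall x, 0 < x -> is_derive x 1 K ((nu * K x - T x) / x))
  (dT : forall x, 0 < x -> is_derive x 1 T ((- nu * T x - x ^+ 2 * K x) / x))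
  (wronsk : forall x, 0 < x -> P x * T x + S x * K x = 1).

(** Since theta P = nu P + S, the function is P (a - A) with a = theta P / P. The factor P turns the
    quadratic Riccati equation into a linear one with source (q - theta A - A^2) P. *)
Lemma is_derive_riccatiI A dA x : 0 < x ->
  is_derive x 1 A (dA / x) ->
  is_derive x 1 (fun x => S x + nu * P x - A x * P x)
    (((x ^+ 2 + nu ^+ 2 - dA - A x ^+ 2) * P x -
      A x * (S x + nu * P x - A x * P x)) / x).
Proof.
move=> x0 dAE; have dPx := dP x0; have dSx := dS x0.
eapply is_derive_eq.
  exact: (is_derive_addf (is_derive_addf dSx
    (is_derive_mulf (is_derive_cstf nu x) dPx))
    (is_derive_oppf (is_derive_mulf dAE dPx))).
by rewrite /=; field; rewrite gt_eqF.
Qed.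

(** The source term is nonpositive, so negativity of P (a - A) propagates to the right from x1,
    where [S_le] bounds a by nu + x1^2 / (2 (nu + 1)). *)
Lemma riccatiI_upper A (dA : R -> R) x :
  (forall x, 0 < x -> is_derive x 1 A (dA x / x)) ->
  (forall x, 0 < x -> x ^+ 2 + nu ^+ 2 <= dA x + A x ^+ 2) ->
  (forall x, 0 < x -> exists2 x1 : R, 0 < x1 <= x &
    nu + x1 ^+ 2 / (2 * (nu + 1)) < A x1) ->
  0 < x -> S x + nu * P x < A x * P x.
Proof.
move=> dAE hA near0 x0; have [x1 /andP[x10 x1x] hx1] := near0 _ x0.
rewrite -subr_lt0.
pose D z := S z + nu * P z - A z * P z.
pose dD z := (z ^+ 2 + nu ^+ 2 - dA z - A z ^+ 2) * P z - A z * D z.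
apply: (gronwall_theta x10 x1x (A := A) (dD := dD) (D := D)).
- by move=> z /dAE; exact: is_derive_continuous.
- by move=> z z0; exact: (is_derive_riccatiI z0 (dAE z z0)).
- move=> z z0; rewrite subrK mulr_le0_ge0 ?(ltW (P_gt0 z0))//.
  by have := hA _ z0; lra.
- rewrite subr_lt0; have h1 := S_le x10.
  have h2 := ltr_pM2r (P_gt0 x10); rewrite -h2 in hx1.
  rewrite mulrDl in hx1; apply: le_lt_trans hx1.
  by rewrite [leLHS]addrC lerD2l; exact: h1.
Qed.

Lemma riccatiI_lower A (dA : R -> R) x :
  (forall x, 0 < x -> is_derive x 1 A (dA x / x)) ->
  (forall x, 0 < x -> dA x + A x ^+ 2 <= x ^+ 2 + nu ^+ 2) ->
  (forall x, 0 < x -> exists2 x1 : R, 0 < x1 <= x & A x1 < nu) ->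
  0 < x -> A x * P x < S x + nu * P x.
Proof.
move=> dAE hA near0 x0; have [x1 /andP[x10 x1x] hx1] := near0 _ x0.
rewrite -subr_gt0 -oppr_lt0.
pose D z := S z + nu * P z - A z * P z.
pose dD z := - ((z ^+ 2 + nu ^+ 2 - dA z - A z ^+ 2) * P z - A z * D z).
apply: (gronwall_theta x10 x1x (A := A) (dD := dD) (D := fun z => - D z)).
- by move=> z /dAE; exact: is_derive_continuous.
- move=> z z0; have h := is_derive_riccatiI z0 (dAE z z0).
  by apply: (is_derive_eq (is_derive_oppf h)); rewrite /dD mulNr.
- move=> z z0; have := mulr_ge0 (_ : 0 <= z ^+ 2 + nu ^+ 2 - dA z - A z ^+ 2)
    (ltW (P_gt0 z0)).
  have -> : 0 <= z ^+ 2 + nu ^+ 2 - dA z - A z ^+ 2 by have := hA _ z0; lra.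
  move=> /(_ isT); rewrite /dD; move: (P z) (D z) => p d.
  lra.
- rewrite oppr_lt0 subr_gt0; have h1 := S_gt0 x10.
  have h2 := ltr_pM2r (P_gt0 x10); rewrite -h2 in hx1.
  by apply: lt_trans hx1 _; rewrite ltrDr.
Qed.

(** The function is K (b - B) with b = - theta K / K. Its own coefficient is now + B, so deviations
    are amplified to the right and the comparison has to come from infinity. *)
Lemma is_derive_riccatiK B dB x : 0 < x ->
  is_derive x 1 B (dB / x) ->
  is_derive x 1 (fun x => T x - nu * K x - B x * K x)
    ((B x * (T x - nu * K x - B x * K x) +
      (B x ^+ 2 - dB - x ^+ 2 - nu ^+ 2) * K x) / x).
Proof.
move=> x0 dBE; have dKx := dK x0; have dTx := dT x0.
eapply is_derive_eq.
  exact: (is_derive_addf (is_derive_addf dTx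
    (is_derive_oppf (is_derive_mulf (is_derive_cstf nu x) dKx)))
    (is_derive_oppf (is_derive_mulf dBE dKx))).
by rewrite /=; field; rewrite gt_eqF.
Qed.

(** If F = T - nu K - B K were positive at x, the sign would persist and B >= 0 would make F
    nondecreasing, so F would stay above F x, whereas the decay of K and T brings it below any
    positive level. *)
Lemma riccatiK_upper B (dB : R -> R) x :
  (forall x, 0 < x -> is_derive x 1 B (dB x / x)) ->
  (forall x, 0 < x -> 0 <= B x) ->
  (forall x, 0 < x -> x ^+ 2 + nu ^+ 2 <= B x ^+ 2 - dB x) ->
  0 < x -> T x - nu * K x <= B x * K x.
Proof.
move=> dBE B0 hB x0; rewrite -subr_le0 leNgt; apply/negP => F0.
pose F z := T z - nu * K z - B z * K z.
pose r z := (B z ^+ 2 - dB z - z ^+ 2 - nu ^+ 2) * K z.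
have r0 (z : R) : 0 < z -> 0 <= r z.
  move=> z0; rewrite mulr_ge0 ?(ltW (K_gt0 z0))//.
  by have := hB _ z0; lra.
pose dF z := - (B z * F z + r z).
have dFE (z : R) : 0 < z -> is_derive z 1 (fun z => - F z) (dF z / z).
  move=> z0; have h := is_derive_riccatiK z0 (dBE z z0).
  by apply: (is_derive_eq (is_derive_oppf h)); rewrite /dF mulNr.
have Fpos (z : R) : x <= z -> 0 < F z.
  move=> xz; rewrite -oppr_lt0.
  apply: (gronwall_theta x0 xz (A := fun z => - B z) (dD := dF)
    (D := fun z => - F z)) => //.
  - by move=> u /dBE h; apply: continuousN; exact: is_derive_continuous h.
  - by move=> u /r0; rewrite /dF; move: (r u) (F u) => *; lra.
  - by rewrite oppr_lt0.
have Fge (z : R) : x <= z -> F x <= F z.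
  move=> xz; rewrite -lerN2.
  apply: (is_derive_le0_le xz (dF := fun z => dF z / z) (F := fun z => - F z)).
    by move=> u /andP[xu _]; apply: dFE; exact: lt_le_trans xu.
  move=> u /andP[xu _]; have u0 := lt_le_trans x0 xu.
  rewrite mulr_le0_ge0 ?invr_ge0 ?(ltW u0)// /dF oppr_le0.
  by rewrite addr_ge0 ?r0// mulr_ge0 ?B0// ltW// Fpos.
(* As nu > -1, F <= T - nu K <= T + K, and each summand is at most C z exp(1 - z) for z >= 1. *)
have C2 : 0 <= 2 * C by rewrite mulr_ge0.
have [z [z1 xz] hz] := linear_expRN_small x C2 F0.
have z0 : 0 < z by lra.
have := lt_le_trans hz (Fge _ xz); apply/negP; rewrite -leNgt.
have d0 := K_decay z1; have d1 := T_decay z1; have kz := K_gt0 z0.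
have h1 : 0 <= B z * K z by rewrite mulr_ge0 ?B0// ltW.
have h3 : 0 <= (1 + nu) * K z by apply: mulr_ge0; [move: nu1; lra|exact: ltW].
have h4 : C * expR (1 - z) <= z * (C * expR (1 - z)).
  by rewrite ler_peMl// mulr_ge0 ?expR_ge0.
rewrite /F; lra.
Qed.

(** Mirror argument: F < 0 would keep F below F x. As T > 0, - F < (nu + B) K, and the linear bound
    on B makes this tend to 0. *)
Lemma riccatiK_lower B (dB : R -> R) (c x : R) : 0 <= nu -> 0 <= c ->
  (forall x, 0 < x -> is_derive x 1 B (dB x / x)) ->
  (forall x, 0 < x -> 0 <= B x) ->
  (forall x, 1 <= x -> B x <= c * x) ->
  (forall x, 0 < x -> B x ^+ 2 - dB x <= x ^+ 2 + nu ^+ 2) ->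
  0 < x -> B x * K x <= T x - nu * K x.
Proof.
move=> nu0 c0 dBE B0 Bc hB x0; rewrite -subr_ge0 leNgt; apply/negP => F0.
pose F z := T z - nu * K z - B z * K z.
pose r z := (B z ^+ 2 - dB z - z ^+ 2 - nu ^+ 2) * K z.
have r0 (z : R) : 0 < z -> r z <= 0.
  move=> z0; rewrite mulr_le0_ge0 ?(ltW (K_gt0 z0))//.
  by have := hB _ z0; lra.
pose dF z := B z * F z + r z.
have dFE (z : R) : 0 < z -> is_derive z 1 F (dF z / z).
  by move=> z0; exact: (is_derive_riccatiK z0 (dBE z z0)).
have Fneg (z : R) : x <= z -> F z < 0.
  move=> xz.
  apply: (gronwall_theta x0 xz (A := fun z => - B z) (dD := dF) (D := F)) => //.
  - by move=> u /dBE h; apply: continuousN; exact: is_derive_continuous h.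
  - by move=> u /r0; rewrite /dF; move: (r u) (F u) => *; lra.
have Fle (z : R) : x <= z -> F z <= F x.
  move=> xz.
  apply: (is_derive_le0_le xz (dF := fun z => dF z / z) (F := F)).
    by move=> u /andP[xu _]; apply: dFE; exact: lt_le_trans xu.
  move=> u /andP[xu _]; have u0 := lt_le_trans x0 xu.
  rewrite mulr_le0_ge0 ?invr_ge0 ?(ltW u0)// /dF.
  have := mulr_ge0_le0 (B0 _ u0) (ltW (Fneg _ xu)); have := r0 _ u0.
  by move: (r u) (B u * F u) => *; lra.
have C2 : 0 <= (nu + c) * C by rewrite mulr_ge0 ?addr_ge0.
have F1 : 0 < - F x by rewrite oppr_gt0.
have [z [z1 xz] hz] := linear_expRN_small x C2 F1.
have z0 : 0 < z by lra.
have := Fle _ xz; apply/negP; rewrite -ltNge.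
have d0 := K_decay z1; have kz := K_gt0 z0; have tz := T_gt0 z0.
rewrite ltrNr in hz; apply: (lt_le_trans hz).
have h1 : (nu + B z) * K z <= ((nu + c) * z) * K z.
  by rewrite ler_wpM2r ?(ltW kz)// mulrDl lerD ?Bc// ler_peMr.
have h2 : ((nu + c) * z) * K z <= ((nu + c) * z) * (C * expR (1 - z)).
  by rewrite ler_wpM2l// mulr_ge0 ?addr_ge0// ltW.
rewrite /F; lra.
Qed.

(* With y = sqrt Q and al = theta Q / (4 Q), the functions y - al and y + al are
   the logarithmic derivatives of the WKB approximations Q^(-1/4) exp(+- int y). *)
Lemma product_gt y al (dal : R -> R) x :
  (forall x, 0 < x -> is_derive x 1 y (2 * al x * y x / x)) ->
  (forall x, 0 < x -> is_derive x 1 al (dal x / x)) ->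
  (forall x, 0 < x -> 0 < y x) -> (forall x, 0 < x -> 0 <= al x) ->
  (forall x, 0 < x -> x ^+ 2 + nu ^+ 2 <= y x ^+ 2 + al x ^+ 2 - dal x) ->
  (forall x, 0 < x -> exists2 x1 : R, 0 < x1 <= x &
    nu + x1 ^+ 2 / (2 * (nu + 1)) < y x1 - al x1) ->
  0 < x -> 1 < 2 * y x * (P x * K x).
Proof.
move=> dy da y0 a0 res near0 x0.
have h1 := @riccatiI_upper (fun x => y x - al x)
  (fun x => 2 * al x * y x - dal x) x _ _ near0 x0.
have {}h1 : S x + nu * P x < (y x - al x) * P x.
  apply: h1 => z z0.
    apply: (is_derive_eq (is_derive_addf (dy _ z0) (is_derive_oppf (da _ z0)))).
    by rewrite [RHS]mulrBl.
  by have := res _ z0; rewrite !expr2; lra.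
have h2 : T x - nu * K x <= (y x + al x) * K x.
  apply: (@riccatiK_upper (fun x => y x + al x)
    (fun x => 2 * al x * y x + dal x) x) => // z z0.
  - apply: (is_derive_eq (is_derive_addf (dy _ z0) (da _ z0))).
    by rewrite [RHS]mulrDl.
  - by rewrite addr_ge0 ?a0// ltW// y0.
  - by have := res _ z0; rewrite !expr2; lra.
(* (S + nu P) K + P (T - nu K) is the Wronskian 1; in the sum of the two bounds the terms in [al]
   cancel, leaving 2 y P K. *)
have W := wronsk x0; have p0 := P_gt0 x0; have k0 := K_gt0 x0.
have h3 := ler_wpM2l (ltW p0) h2.
have h4 : (S x + nu * P x) * K x <
    (y x - al x) * P x * K x by rewrite ltr_pM2r.
lra.
Qed.

Lemma product_le y al (dal : R -> R) (c x : R) : 0 <= nu -> 0 <= c ->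
  (forall x, 0 < x -> is_derive x 1 y (2 * al x * y x / x)) ->
  (forall x, 0 < x -> is_derive x 1 al (dal x / x)) ->
  (forall x, 0 < x -> 0 < y x) -> (forall x, 0 < x -> 0 <= al x) ->
  (forall x, 1 <= x -> y x + al x <= c * x) ->
  (forall x, 0 < x -> y x ^+ 2 + al x ^+ 2 - dal x <= x ^+ 2 + nu ^+ 2) ->
  (forall x, 0 < x -> exists2 x1 : R, 0 < x1 <= x & y x1 - al x1 < nu) ->
  0 < x -> 2 * y x * (P x * K x) <= 1.
Proof.
move=> nu0 c0 dy da y0 a0 yc res near0 x0.
have h1 := @riccatiI_lower (fun x => y x - al x)
  (fun x => 2 * al x * y x - dal x) x _ _ near0 x0.
have {}h1 : (y x - al x) * P x < S x + nu * P x.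
  apply: h1 => z z0.
    apply: (is_derive_eq (is_derive_addf (dy _ z0) (is_derive_oppf (da _ z0)))).
    by rewrite [RHS]mulrBl.
  by have := res _ z0; rewrite !expr2; lra.
have h2 : (y x + al x) * K x <= T x - nu * K x.
  apply: (@riccatiK_lower (fun x => y x + al x)
    (fun x => 2 * al x * y x + dal x) c x nu0) => // z z0.
  - apply: (is_derive_eq (is_derive_addf (dy _ z0) (da _ z0))).
    by rewrite [RHS]mulrDl.
  - by rewrite addr_ge0 ?a0// ltW// y0.
  - by have := res _ z0; rewrite !expr2; lra.
have W := wronsk x0; have p0 := P_gt0 x0; have k0 := K_gt0 x0.
have h3 := ler_wpM2l (ltW p0) h2.
have h4 : (y x - al x) * P x * K x <
  (S x + nu * P x) * K x by rewrite ltr_pM2r.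
lra.
Qed.

End comparison.

(** * Application to the Bessel functions, with y = sqrt Q *)

Section bessel_comparison.
Context {R : realType}.
Implicit Types (nu x : R) (y al dal Q : R -> R).

Let C nu : R := besselK nu 1 + besselK (nu + 1) 1.

Let C_ge0 nu : 0 <= C nu.
Proof. by rewrite addr_ge0// ltW// besselK_gt0. Qed.

Let K_decay nu x : 1 <= x -> besselK nu x <= C nu * expR (1 - x).
Proof.
move=> x1; apply: le_trans (besselK_decay nu x1) _; rewrite mulrC.
by rewrite ler_wpM2r ?expR_ge0// lerDl ltW// besselK_gt0.
Qed.

Let T_decay nu x : 1 <= x ->
  x * besselK (nu + 1) x <= C nu * x * expR (1 - x).
Proof.
move=> x1; have x0 : 0 <= x by exact: le_trans x1.
rewrite [C nu * x]mulrC -mulrA; apply: ler_wpM2l => //.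
apply: le_trans (besselK_decay _ x1) _; rewrite mulrC.
by rewrite ler_wpM2r ?expR_ge0// lerDr ltW// besselK_gt0.
Qed.

Let T_gt0 nu x : 0 < x -> 0 < x * besselK (nu + 1) x.
Proof. by move=> x0; rewrite mulr_gt0// besselK_gt0. Qed.

Lemma besselIK_gt nu y al dal x : -1 < nu ->
  (forall x, 0 < x -> is_derive x 1 y (2 * al x * y x / x)) ->
  (forall x, 0 < x -> is_derive x 1 al (dal x / x)) ->
  (forall x, 0 < x -> 0 < y x) -> (forall x, 0 < x -> 0 <= al x) ->
  (forall x, 0 < x -> x ^+ 2 + nu ^+ 2 <= y x ^+ 2 + al x ^+ 2 - dal x) ->
  (forall x, 0 < x -> exists2 x1 : R, 0 < x1 <= x &
    nu + x1 ^+ 2 / (2 * (nu + 1)) < y x1 - al x1) ->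
  0 < x -> 1 < 2 * y x * (besselI nu x * besselK nu x).
Proof.
move=> nu1 h1 h2 h3 h4 h5 h6 x0.
exact: (@product_gt R nu (C nu) (besselI nu)
  (fun x => x * besselI (nu + 1) x) (besselK nu) (fun x => x * besselK (nu + 1) x)
  nu1 (@C_ge0 nu) (fun x hx => besselI_gt0 nu1 hx)
  (fun x hx => besselIS_le nu1 hx) (@besselK_gt0 R nu)
  (@K_decay nu) (@T_decay nu)
  (fun x hx => theta_besselI nu1 hx) (fun x hx => theta_besselIS nu1 hx)
  (@theta_besselK R nu) (@theta_besselKS R nu)
  (fun x hx => wronskian nu1 hx) _ _ _ _ h1 h2 h3 h4 h5 h6 x0).
Qed.

Lemma besselIK_le nu y al dal (c x : R) : 0 <= nu -> 0 <= c ->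
  (forall x, 0 < x -> is_derive x 1 y (2 * al x * y x / x)) ->
  (forall x, 0 < x -> is_derive x 1 al (dal x / x)) ->
  (forall x, 0 < x -> 0 < y x) -> (forall x, 0 < x -> 0 <= al x) ->
  (forall x, 1 <= x -> y x + al x <= c * x) ->
  (forall x, 0 < x -> y x ^+ 2 + al x ^+ 2 - dal x <= x ^+ 2 + nu ^+ 2) ->
  (forall x, 0 < x -> exists2 x1 : R, 0 < x1 <= x & y x1 - al x1 < nu) ->
  0 < x -> 2 * y x * (besselI nu x * besselK nu x) <= 1.
Proof.
move=> nu0 c0 h1 h2 h3 h4 h5 h6 h7 x0; have nu1 : -1 < nu by lra.
exact: (@product_le R nu (C nu) (besselI nu)
  (fun x => x * besselI (nu + 1) x) (besselK nu) (fun x => x * besselK (nu + 1) x)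
  (@C_ge0 nu) (fun x hx => besselI_gt0 nu1 hx)
  (fun x hx => besselIS_gt0 nu1 hx) (@besselK_gt0 R nu) (@T_gt0 nu)
  (@K_decay nu)
  (fun x hx => theta_besselI nu1 hx) (fun x hx => theta_besselIS nu1 hx)
  (@theta_besselK R nu) (@theta_besselKS R nu)
  (fun x hx => wronskian nu1 hx) _ _ _ _ _ nu0 c0 h1 h2 h3 h4 h5 h6 h7 x0).
Qed.

Lemma is_derive_theta_sqrt Q (dQ z : R) : 0 < Q z -> 0 < z ->
  is_derive z 1 Q (dQ / z) ->
  is_derive z 1 (fun z => Num.sqrt (Q z))
    (2 * (dQ / (4 * Q z)) * Num.sqrt (Q z) / z).
Proof.
move=> q0 z0 dQE; apply: (is_derive_eq (is_derive_sqrtf q0 dQE)).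
have E := sqr_sqrtr (ltW q0); have y0 : 0 < Num.sqrt (Q z) by rewrite sqrtr_gt0.
move: (Num.sqrt _) E y0 => y <- y0.
by field; rewrite !gt_eqF.
Qed.

Lemma is_derive_theta_log Q Q1 (dQ1 z : R) : 0 < Q z -> 0 < z ->
  is_derive z 1 Q (Q1 z / z) -> is_derive z 1 Q1 (dQ1 / z) ->
  is_derive z 1 (fun z => Q1 z / (4 * Q z))
    ((dQ1 / (4 * Q z) - 4 * (Q1 z / (4 * Q z)) ^+ 2) / z).
Proof.
move=> q0 z0 dQ dQ1E; have q4 : 4 * Q z != 0 by rewrite mulf_neq0// gt_eqF.
by derive_tac; field; rewrite !gt_eqF.
Qed.

Lemma wkb_residualE (q q1 q2 : R) : 0 < q ->
  q + (q1 / (4 * q)) ^+ 2 - (q2 / (4 * q) - 4 * (q1 / (4 * q)) ^+ 2) =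
  q + (5 * q1 ^+ 2 - 4 * q * q2) / (16 * q ^+ 2).
Proof. by move=> q0; field; rewrite gt_eqF. Qed.

(** Q1 and Q2 play theta Q and theta^2 Q; the residual condition is multiplied by 16 Q^2 to clear
    denominators, which makes it polynomial when Q is. *)
Lemma besselIK_gt_wkb nu Q Q1 Q2 x : -1 < nu ->
  (forall x, 0 < x -> is_derive x 1 Q (Q1 x / x)) ->
  (forall x, 0 < x -> is_derive x 1 Q1 (Q2 x / x)) ->
  (forall x, 0 < x -> 0 < Q x) -> (forall x, 0 < x -> 0 <= Q1 x) ->
  (forall x, 0 < x ->
    (x ^+ 2 + nu ^+ 2 - Q x) * (16 * Q x ^+ 2) <=
    5 * Q1 x ^+ 2 - 4 * Q x * Q2 x) ->
  (forall x, 0 < x -> exists2 x1 : R, 0 < x1 <= x &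
    nu + x1 ^+ 2 / (2 * (nu + 1)) < Num.sqrt (Q x1) - Q1 x1 / (4 * Q x1)) ->
  0 < x -> 1 < 2 * Num.sqrt (Q x) * (besselI nu x * besselK nu x).
Proof.
move=> nu1 dQ dQ1 Q0 Q10 res near0.
apply: (@besselIK_gt nu (fun z => Num.sqrt (Q z)) (fun z => Q1 z / (4 * Q z))
  (fun z => Q2 z / (4 * Q z) - 4 * (Q1 z / (4 * Q z)) ^+ 2)) => //.
- by move=> z z0; exact: is_derive_theta_sqrt (Q0 _ z0) z0 (dQ _ z0).
- by move=> z z0; exact: is_derive_theta_log (Q0 _ z0) z0 (dQ _ z0) (dQ1 _ z0).
- by move=> z z0; rewrite sqrtr_gt0 Q0.
- by move=> z z0; rewrite divr_ge0 ?Q10// mulr_ge0// ltW// Q0.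
- move=> z z0; have q0 := Q0 _ z0; rewrite sqr_sqrtr ?(ltW q0)// wkb_residualE//.
  rewrite -lerBlDl ler_pdivlMr ?mulr_gt0 ?exprn_gt0//; exact: res.
Qed.

Lemma besselIK_le_wkb nu Q Q1 Q2 (c x : R) : 0 <= nu -> 0 <= c ->
  (forall x, 0 < x -> is_derive x 1 Q (Q1 x / x)) ->
  (forall x, 0 < x -> is_derive x 1 Q1 (Q2 x / x)) ->
  (forall x, 0 < x -> 0 < Q x) -> (forall x, 0 < x -> 0 <= Q1 x) ->
  (forall x, 1 <= x -> Num.sqrt (Q x) + Q1 x / (4 * Q x) <= c * x) ->
  (forall x, 0 < x ->
    5 * Q1 x ^+ 2 - 4 * Q x * Q2 x <=
    (x ^+ 2 + nu ^+ 2 - Q x) * (16 * Q x ^+ 2)) ->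
  (forall x, 0 < x -> exists2 x1 : R, 0 < x1 <= x &
    Num.sqrt (Q x1) - Q1 x1 / (4 * Q x1) < nu) ->
  0 < x -> 2 * Num.sqrt (Q x) * (besselI nu x * besselK nu x) <= 1.
Proof.
move=> nu0 c0 dQ dQ1 Q0 Q10 Qc res near0.
apply: (@besselIK_le nu (fun z => Num.sqrt (Q z)) (fun z => Q1 z / (4 * Q z))
  (fun z => Q2 z / (4 * Q z) - 4 * (Q1 z / (4 * Q z)) ^+ 2) c) => //.
- by move=> z z0; exact: is_derive_theta_sqrt (Q0 _ z0) z0 (dQ _ z0).
- by move=> z z0; exact: is_derive_theta_log (Q0 _ z0) z0 (dQ _ z0) (dQ1 _ z0).
- by move=> z z0; rewrite sqrtr_gt0 Q0.
- by move=> z z0; rewrite divr_ge0 ?Q10// mulr_ge0// ltW// Q0.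
- move=> z z0; have q0 := Q0 _ z0; rewrite sqr_sqrtr ?(ltW q0)// wkb_residualE//.
  rewrite -lerBrDl ler_pdivrMr ?mulr_gt0 ?exprn_gt0//; exact: res.
Qed.

End bessel_comparison.

(** * The bound with 1/5 and its sharpness *)

Section sharp_bounds.
Context {R : realType}.
Implicit Types (nu x z : R).

(* At Q = x^2 + nu^2 + 1/5 the WKB residual is the perfect square
   20 (x^2 - 2/5 Q)^2: this is where the constant 1/5 comes from. *)
Lemma besselIK_gt_sqrt nu x : -1 < nu -> 0 < x ->
  1 < 2 * Num.sqrt (x ^+ 2 + nu ^+ 2 + 1 / 5) * (besselI nu x * besselK nu x).
Proof.
move=> nu1 x0; set k := nu ^+ 2 + 1 / 5.
have k0 : 1 / 5 <= k by rewrite /k; have := sqr_ge0 nu; lra.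
have Q0 z : 0 < z ^+ 2 + k by have := sqr_ge0 z; lra.
rewrite -addrA -/k.
apply: (@besselIK_gt_wkb _ nu (fun z => z ^+ 2 + k) (fun z => 2 * z ^+ 2)
  (fun z => 4 * z ^+ 2)) => //.
- by move=> z z0; derive_tac; field; rewrite gt_eqF.
- by move=> z z0; derive_tac; field; rewrite gt_eqF.
- by move=> z _; rewrite mulr_ge0 ?sqr_ge0.
- move=> z _; have := sqr_ge0 (z ^+ 2 - 2 / 5 * (z ^+ 2 + k)).
  by rewrite /k !expr2; move: (z * z) (nu * nu) => a b; lra.
- move=> z z0.
  have m0 : nu < Num.sqrt k.
    apply: (le_lt_trans (ler_norm nu)); rewrite -sqrtr_sqr ltr_sqrt; last by lra.
    by rewrite /k; lra.
  set d := Num.sqrt k - nu; have d0 : 0 < d by rewrite subr_gt0.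
  (* [c] collects two errors of order x1^2: the first from the bound on theta I / I, the 5 / 2 from
     theta Q / (4 Q) = x1^2 / (2 Q) with Q >= 1 / 5. The choice of x1 keeps c x1^2 at most half the
     gap d. *)
  set c := 1 / (2 * (nu + 1)) + 5 / 2.
  have n0 : 0 < 1 / (2 * (nu + 1)) by rewrite divr_gt0// mulr_gt0//; lra.
  have c0 : 0 < c by rewrite /c; lra.
  pose x1 := Num.min (Num.min z 1) (d / (2 * c)).
  have x10 : 0 < x1 by rewrite !lt_min z0 ltr01 divr_gt0// mulr_gt0.
  have x1z : x1 <= z by rewrite !ge_min lexx.
  have x11 : x1 <= 1 by rewrite !ge_min lexx orbT.
  have x1d : x1 <= d / (2 * c) by rewrite !ge_min lexx orbT.
  exists x1; first by rewrite x10.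
  have h1 : Num.sqrt k <= Num.sqrt (x1 ^+ 2 + k).
    by rewrite ler_sqrt ?(ltW (Q0 _))// lerDr sqr_ge0.
  have h2 : 2 * x1 ^+ 2 / (4 * (x1 ^+ 2 + k)) <= 5 / 2 * x1 ^+ 2.
    rewrite ler_pdivrMr ?mulr_gt0//.
    have := mulr_ge0 (sqr_ge0 x1) (sqr_ge0 x1).
    have := ler_wpM2l (sqr_ge0 x1) k0; move: (x1 ^+ 2) => u; lra.
  have h3 : x1 ^+ 2 / (2 * (nu + 1)) = 1 / (2 * (nu + 1)) * x1 ^+ 2.
    by rewrite mulrC mul1r.
  have h4 : c * x1 ^+ 2 <= d / 2.
    apply: (@le_trans _ _ (c * x1)).
      by rewrite ler_wpM2l ?(ltW c0)// expr2 ler_piMr// ltW.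
    have := ler_wpM2l (ltW c0) x1d.
    by have -> : c * (d / (2 * c)) = d / 2 by field; rewrite gt_eqF.
  rewrite h3; move: h1 h2 h4 d0; rewrite /c /d.
  move: (x1 ^+ 2) (1 / _) (Num.sqrt k) (2 * x1 ^+ 2 / _) (Num.sqrt (x1 ^+ 2 + k)).
  by clear; move=> *; lra.
Qed.

Lemma ler_normM2 (a b A B : R) : `|a| <= A -> `|b| <= B -> `|a * b| <= A * B.
Proof. by move=> ha hb; rewrite normrM ler_pM. Qed.

(* The WKB residual at Q = N / t + c, after multiplication by t^2, where
   x^2 = N s / t: its terms of order N^2 add up to - 16 e N^2. *)
Lemma wkb_residual_le0 (N e s c t g1 g2 : R) :
  0 < e <= 1 -> 200 <= 16 * e * N -> 1 <= N -> 0 <= s <= 1 ->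
  c = s - 5 / 4 * s ^+ 2 - e -> t = 1 - s ->
  g1 = s * t * (2 - 5 * s) -> g2 = 2 * s * t * (2 - 14 * s + 15 * s ^+ 2) ->
  16 * c * (N + t * c) ^+ 2 + 5 * (2 * N * s + t * g1) ^+ 2 -
    4 * (N + t * c) * (4 * N * s + t * g2) <= 0.
Proof.
move=> /andP[e0 e1] eN N1 /andP[s0 s1] cE tE g1E g2E.
have t0 : 0 <= t by rewrite tE; lra.
have t1 : t <= 1 by rewrite tE; lra.
have hs : `|s| <= 1 by rewrite ger0_norm.
have ht : `|t| <= 1 by rewrite ger0_norm.
have ss : 0 <= s ^+ 2 <= s by rewrite sqr_ge0 expr2 ler_piMr.
have hc : `|c| <= 5 / 4.
  rewrite cE ler_norml; have := sqr_ge0 (s - 2 / 5); move/andP: ss => [].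
  by rewrite !expr2 => *; apply/andP; split; lra.
have st : `|s * t| <= 1 / 4.
  rewrite ger0_norm ?mulr_ge0// tE; have := sqr_ge0 (s - 1 / 2).
  by rewrite expr2; lra.
have hg1 : `|g1| <= 1.
  rewrite g1E.
  apply: le_trans (ler_normM2 st (_ : `|2 - 5 * s| <= 3)) _; last by lra.
  by rewrite ler_norml; apply/andP; split; lra.
have hg2 : `|g2| <= 2.
  have -> : g2 = 2 * (s * t) * (2 - 14 * s + 15 * s ^+ 2) by rewrite g2E; ring.
  have h2 : `|2 * (s * t)| <= 1 / 2 by rewrite normrM ger0_norm//; lra.
  apply: le_trans (ler_normM2 h2 (_ : `|2 - 14 * s + 15 * s ^+ 2| <= 3)) _;
    last by lra.
  rewrite ler_norml; have := sqr_ge0 (s - 7 / 15); move/andP: ss => [].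
  by rewrite !expr2 => *; apply/andP; split; lra.
have E : 16 * c * (N + t * c) ^+ 2 + 5 * (2 * N * s + t * g1) ^+ 2 -
    4 * (N + t * c) * (4 * N * s + t * g2) =
  - (16 * e * N) * N + N * (32 * (t * (c * c)) + 20 * (s * (t * g1)) -
    4 * (t * g2) - 16 * (t * (c * s))) +
  (16 * (t * t * (c * (c * c))) + 5 * (t * t * (g1 * g1)) - 4 * (t * t * (c * g2))).
  have -> : e = s - 5 / 4 * s ^+ 2 - c by rewrite cE; ring.
  by field.
rewrite E.
(* [L] is the factor of N and [M] the term free of an explicit N; both are at most 100, and - 200 N
   + 100 N + 100 <= 0 for N >= 1, whence the 200 in the hypothesis. *)
set L := 32 * _ + _ - _ - _; set M := 16 * _ + _ - _ in E *.
have hcc := ler_normM2 hc hc.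
have h1 := ler_normM2 ht hcc; have h2 := ler_normM2 hs (ler_normM2 ht hg1).
have h3 := ler_normM2 ht hg2; have h4 := ler_normM2 ht (ler_normM2 hc hs).
have htt := ler_normM2 ht ht.
have h5 := ler_normM2 htt (ler_normM2 hc hcc).
have h6 := ler_normM2 htt (ler_normM2 hg1 hg1).
have h7 := ler_normM2 htt (ler_normM2 hc hg2).
have hL : L <= 100.
  move: h1 h2 h3 h4; rewrite !ler_norml /L.
  by move=> /andP[_ ?] /andP[_ ?] /andP[? _] /andP[? _]; lra.
have hM : M <= 100.
  move: h5 h6 h7; rewrite !ler_norml /M => /andP[_ ?] /andP[_ ?] /andP[? _].
  lra.
have N0 : 0 <= N by lra.
have := ler_wpM2l N0 hL; have := ler_wpM2l N0 eN.
move: (16 * e * N) => u *; lra.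
Qed.

Lemma besselIK_le_sqrt nu (e : R) : 0 < e <= 1 -> 20 / e <= nu ->
  exists2 x : R, 0 < x &
    2 * Num.sqrt (x ^+ 2 + nu ^+ 2 + (1 / 5 - e)) *
      (besselI nu x * besselK nu x) <= 1.
Proof.
move=> /andP[e0 e1] nue.
have nu20 : 20 <= nu.
  by apply: le_trans nue; rewrite ler_pdivlMr// ler_piMr.
have nu0 : 0 < nu by lra.
pose N := nu ^+ 2.
have N20 : 400 <= N.
  by rewrite /N; have := sqr_ge0 (nu - 20); rewrite !expr2; lra.
have eN : 200 <= 16 * e * N.
  have : 20 <= nu * e by rewrite -ler_pdivrMr.
  have := ler_wpM2l (ltW (mulr_gt0 nu0 e0)) nu20.
  by rewrite /N expr2; lra.
(* Then s = x^2 / (x^2 + nu^2) = 2 / 5, where s - 5/4 s^2 attains its maximum 1/5. *)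
exists (nu * Num.sqrt (2 / 3)).
  by rewrite mulr_gt0// sqrtr_gt0; lra.
set x := nu * _.
have x0 : 0 < x by rewrite mulr_gt0// sqrtr_gt0; lra.
have xE : x ^+ 2 = 2 / 3 * nu ^+ 2.
  by rewrite exprMn sqr_sqrtr; [ring|lra].
pose s z := z ^+ 2 / (z ^+ 2 + N).
pose Q z := z ^+ 2 + N + (s z - 5 / 4 * s z ^+ 2 - e).
(* Q1 and Q2 are theta Q and theta^2 Q, computed from theta s = 2 s (1 - s). *)
pose Q1 z := 2 * z ^+ 2 + s z * (1 - s z) * (2 - 5 * s z).
pose Q2 z := 4 * z ^+ 2 + 2 * s z * (1 - s z) * (2 - 14 * s z + 15 * s z ^+ 2).
have q0 z : 0 < z ^+ 2 + N by have := sqr_ge0 z; lra.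
have ds z : 0 < z -> is_derive z 1 s (2 * s z * (1 - s z) / z).
  move=> z0; have qn : z ^+ 2 + N != 0 by rewrite gt_eqF.
  rewrite /s; derive_tac; rewrite /s; field.
  by rewrite gt_eqF.
have s01 z : 0 <= s z <= 1.
  rewrite /s divr_ge0 ?sqr_ge0 ?(ltW (q0 z))//= ler_pdivrMr// mul1r lerDl; lra.
have g01 z : -1/4 <= s z - 5 / 4 * s z ^+ 2 <= 1 / 5.
  have /andP[s0 s1] := s01 z; have := sqr_ge0 (s z - 2 / 5).
  have := mulr_ge0 s0 (_ : 0 <= 1 - s z); rewrite subr_ge0 s1 => /(_ isT).
  by rewrite !expr2 => *; apply/andP; split; lra.
have Q0 z : z ^+ 2 + 1 <= Q z by have /andP[? _] := g01 z; rewrite /Q; lra.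
have Qp z : 0 < Q z by have := Q0 z; have := sqr_ge0 z; lra.
have xs z : z ^+ 2 * (1 - s z) = N * s z.
  by rewrite /s; field; rewrite gt_eqF.
have QE : x ^+ 2 + nu ^+ 2 + (1 / 5 - e) = Q x.
  have sE : s x = 2 / 5.
    rewrite /s xE -/N; have -> : 2 / 3 * N + N = 5 / 3 * N by field.
    by field; rewrite gt_eqF//; lra.
  by rewrite /Q sE /N; field.
have tN z : 1 - s z = N / (z ^+ 2 + N) by rewrite /s; field; rewrite gt_eqF.
have Q1_ge0 z : 0 <= Q1 z.
  have /andP[s0 s1] := s01 z.
  have h : N * s z <= z ^+ 2 by rewrite -xs ler_piMr ?sqr_ge0//; lra.
  have h1 : 0 <= s z * (5 - 7 * s z + 5 * (s z * s z)).
    by apply: mulr_ge0 => //; have := sqr_ge0 (s z - 7 / 10); rewrite expr2; lra.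
  have h2 := ler_wpM2r s0 N20.
  by rewrite /Q1; lra.
rewrite QE; apply: (@besselIK_le_wkb _ nu Q Q1 Q2 (nu + 3)).
- exact: ltW.
- lra.
- move=> z z0; have ? := ds _ z0; rewrite /Q.
  by derive_tac; rewrite /Q1; field; rewrite gt_eqF.
- move=> z z0; have ? := ds _ z0; rewrite /Q1.
  by derive_tac; rewrite /Q2; field; rewrite gt_eqF.
- by move=> z _; exact: Qp.
- by move=> z _; exact: Q1_ge0.
- move=> z z1; have /andP[s0 s1] := s01 z.
  have h1 : Num.sqrt (Q z) <= z + nu.
    have zn : 0 <= z + nu by lra.
    rewrite -(ger0_norm zn) -sqrtr_sqr ler_sqrt ?sqr_ge0//.
    have /andP[_ g1] := g01 z.
    have : nu <= z * nu by rewrite ler_peMl// ltW.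
    by move: g1; rewrite /Q /N !expr2; lra.
  have h2 : Q1 z / (4 * Q z) <= 1.
    rewrite ler_pdivrMr ?mulr_gt0// mul1r.
    have t0 : 0 <= 1 - s z by lra.
    have st0 := mulr_ge0 s0 t0; have sts0 := mulr_ge0 st0 s0.
    have st1 : s z * (1 - s z) <= 1 by rewrite mulr_ile1//; lra.
    by have := Q0 z; have := sqr_ge0 z; rewrite /Q1; lra.
  have : nu <= nu * z by rewrite ler_peMr// ltW.
  lra.
- move=> z _; rewrite -subr_le0; have /andP[s0 s1] := s01 z.
  pose t : R := 1 - s z; pose c := s z - 5 / 4 * s z ^+ 2 - e.
  have t0 : 0 < t by rewrite /t tN divr_gt0//; lra.
  have qt : (z ^+ 2 + N) * t = N by rewrite /t tN mulrC divfK// gt_eqF.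
  have e01 : 0 < e <= 1 by rewrite e0.
  have N1 : 1 <= N by lra.
  have h := @wkb_residual_le0 N e (s z) c t _ _ e01 eN N1 (s01 z)
    erefl erefl erefl erefl.
  (* Multiplication by t^2 > 0 uses z^2 + N = N / t and z^2 = N s / t to reach the polynomial form
     of [wkb_residual_le0]. *)
  rewrite -(pmulr_rle0 _ (exprn_gt0 2 t0)); move: h; congr (_ <= 0).
  have xt : z ^+ 2 * t = N * s z by exact: xs.
  have -> : N + t * c = t * Q z by rewrite -[X in X + _]qt /Q /c; ring.
  have -> : 2 * N * s z + t * (s z * t * (2 - 5 * s z)) = t * Q1 z.
    by rewrite -mulrA -xt /Q1 /t; ring.
  have -> : 4 * N * s z + t * (2 * s z * t * (2 - 14 * s z + 15 * s z ^+ 2)) =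
      t * Q2 z.
    by rewrite -mulrA -xt /Q2 /t; ring.
  have -> : z ^+ 2 + nu ^+ 2 - Q z = - c by rewrite /Q /c /N; ring.
  by ring.
(* Here the summand - e provides the starting point: x1 <= e / 2 <= 1 / 2 gives x1^2 <= e / 4, and s
   <= x1^2, so Q x1 <= nu^2 - e / 2 < nu^2. *)
- move=> z z0; pose x1 := Num.min z (e / 2).
  have x10 : 0 < x1 by rewrite lt_min z0 divr_gt0.
  have x1z : x1 <= z by rewrite ge_min lexx.
  have x1e : x1 <= e / 2 by rewrite ge_min lexx orbT.
  exists x1; first by rewrite x10.
  have a0 : 0 <= Q1 x1 / (4 * Q x1) by rewrite divr_ge0 ?Q1_ge0// mulr_ge0// ltW.
  suff : Num.sqrt (Q x1) < nu by lra.
  rewrite -[ltRHS](gtr0_norm nu0) -sqrtr_sqr ltr_sqrt ?exprn_gt0//.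
  have sx : s x1 <= x1 ^+ 2.
    rewrite /s ler_pdivrMr// ler_peMr ?sqr_ge0//.
    by have := sqr_ge0 x1; lra.
  have h : x1 ^+ 2 <= x1 / 2 by rewrite expr2 ler_wpM2l ?(ltW x10)//; lra.
  by have := sqr_ge0 (s x1); rewrite /Q -/N; lra.
- exact: x0.
Qed.

End sharp_bounds.

Theorem theorem4 (R : realType) :
  (forall nu : R, -1 < nu -> forall x : R, 0 < x ->
     bessel_h nu x < 1 / 5 /\
     besselI nu x * besselK nu x
       > 1 / (2 * Num.sqrt (x ^+ 2 + nu ^+ 2 + 1 / 5))) /\
  (forall c : R, c < 1 / 5 ->
     exists nu x : R,
       [/\ -1 < nu, 0 < x, 0 < x ^+ 2 + nu ^+ 2 + c &
           besselI nu x * besselK nu x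
             <= 1 / (2 * Num.sqrt (x ^+ 2 + nu ^+ 2 + c))]).
Proof.
split=> [nu nu1 x x0|c c5].
  have h := besselIK_gt_sqrt nu1 x0.
  have p0 : 0 < besselI nu x * besselK nu x.
    by rewrite mulr_gt0 ?besselI_gt0 ?besselK_gt0.
  have Q0 : 0 < x ^+ 2 + nu ^+ 2 + 1 / 5.
    by have := sqr_ge0 x; have := sqr_ge0 nu; lra.
  rewrite /bessel_h; move: (besselI nu x * besselK nu x) h p0 => p h p0.
  have y0 : 0 < Num.sqrt (x ^+ 2 + nu ^+ 2 + 1 / 5) by rewrite sqrtr_gt0.
  split; last by rewrite ltr_pdivrMr ?mulr_gt0// mulrC.
  rewrite !ltrBlDr; have -> : 1 / 5 + nu ^+ 2 + x ^+ 2 = x ^+ 2 + nu ^+ 2 + 1 / 5.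
    by ring.
  rewrite ltr_pdivrMr ?mulr_gt0 ?exprn_gt0// -(sqr_sqrtr (ltW Q0)).
  move: (Num.sqrt _) h => y h.
  have -> : y ^+ 2 * (4 * p ^+ 2) = (2 * y * p) ^+ 2 by ring.
  by rewrite exprn_egt1.
pose e := Num.min 1 (1 / 5 - c).
have e0 : 0 < e by rewrite lt_min ltr01 subr_gt0.
have e1 : e <= 1 by rewrite ge_min lexx.
have ec : e <= 1 / 5 - c by rewrite ge_min lexx orbT.
(* 20 / e is what [besselIK_le_sqrt] asks for; |c| + 1 gives nu^2 >= nu > - c, so the radicand is
   positive even for very negative c. *)
pose nu := 20 / e + `|c| + 1.
have e20 : 0 < 20 / e by rewrite divr_gt0.
have nue : 20 / e <= nu by rewrite /nu; have := normr_ge0 c; lra.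
have e01 : 0 < e <= 1 by rewrite e0.
have [x x0 h] := besselIK_le_sqrt e01 nue.
have nuc : `|c| + 1 <= nu by rewrite /nu; lra.
have nu1 : 1 <= nu by have := normr_ge0 c; lra.
have nusq : nu <= nu ^+ 2 by rewrite expr2 ler_peMr//; lra.
have Q0 : 0 < x ^+ 2 + nu ^+ 2 + c.
  by have := sqr_ge0 x; have := ler_norm (- c); rewrite normrN; lra.
exists nu, x; split => //; first by lra.
have p0 : 0 < besselI nu x * besselK nu x.
  by rewrite mulr_gt0 ?besselI_gt0 ?besselK_gt0//; lra.
move: (besselI nu x * besselK nu x) h p0 => p h p0.
rewrite ler_pdivlMr ?mulr_gt0 ?sqrtr_gt0// mulrC; apply: le_trans h.
rewrite ler_wpM2r ?(ltW p0)// ler_wpM2l// ler_sqrt; lra.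
Qed.
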